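(* Let $N\ge1$ be an integer and let $\mathbf x[1],\dots,\mathbf x[N]$ be independent, identically distributed zero-mean Gaussian random vectors in $\mathbb{R}^4$, $\mathbf x[n]=[I_1[n],Q_1[n],I_2[n],Q_2[n]]^{\mathsf T}$, with covariance matrix $\mathbf\Sigma(\sigma_1,\sigma_2,\rho,\phi)$ (see context), where $\sigma_1>0$, $\sigma_2>0$, $0\le\rho\le1$, $\phi\in\mathbb{R}$. Let $$\hat\sigma_k=\sqrt{\frac{1}{2N}\sum_{n=1}^N\bigl(I_k[n]^2+Q_k[n]^2\bigr)},\qquad k=1,2.$$ Then $\hat\sigma_1$ has probability density function, for $x\ge0$, $$f_{\hat\sigma_1}(x\,|\,\sigma_1,N)=\frac{2N^N}{\Gamma(N)\,\sigma_1^{2N}}\,x^{2N-1}\exp\left(-\frac{Nx^2}{\sigma_1^2}\right),$$ where $\Gamma$ is the gamma function, and the same holds for $\hat\sigma_2$ with $\sigma_1$ replaced by $\sigma_2$.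
   Context: The structured covariance matrix is the real $4\times4$ block matrix $$\mathbf\Sigma(\sigma_1,\sigma_2,\rho,\phi)=\begin{bmatrix}\sigma_1^2\mathbf 1_2 & \rho\sigma_1\sigma_2\mathbf M(\phi)\\ \rho\sigma_1\sigma_2\mathbf M(\phi)^{\mathsf T}&\sigma_2^2\mathbf 1_2\end{bmatrix},$$ where $\mathbf 1_2$ is the $2\times2$ identity and $\mathbf M(\phi)$ is either $\begin{bmatrix}\cos\phi&\sin\phi\\ \sin\phi&-\cos\phi\end{bmatrix}$ (QTMS radar) or $\begin{bmatrix}\cos\phi&\sin\phi\\-\sin\phi&\cos\phi\end{bmatrix}$ (standard noise radar). *)

(* Defs.v *)
From HB Require Import structures.
From mathcomp Require Import all_boot all_order all_algebra.
From mathcomp Require Import all_classical all_reals all_analysis.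
Set Implicit Arguments.
Unset Strict Implicit.
Unset Printing Implicit Defensive.
Import Order.TTheory GRing.Theory Num.Theory.
Import numFieldNormedType.Exports.
Local Open Scope classical_set_scope.
Local Open Scope ring_scope.

Inductive radar := QTMS | StandardNoise.

Definition phase_mx (R : realType) (r : radar) (phi : R) : 'M[R]_2 :=
  let entries := match r with
    | QTMS => [:: [:: cos phi; sin phi]; [:: sin phi; - cos phi]]
    | StandardNoise => [:: [:: cos phi; sin phi]; [:: - sin phi; cos phi]]
    end in
  \matrix_(i, j) nth 0 (nth [::] entries i) j.

Definition cov_mx (R : realType) (r : radar) (sigma1 sigma2 rho phi : R)
    : 'M[R]_4 :=
  let C := (rho * sigma1 * sigma2) *: phase_mx r phi in
  @block_mx R 2 2 2 2 (sigma1 ^+ 2)%:M C C^T (sigma2 ^+ 2)%:M.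

(* For s = 0 this is the Dirac mass at m; the library's normal_prob m 0 is
   instead the uniform law on `[0, 1]. *)
Definition gaussian_law (R : realType) (m s : R) (A : set R) : \bar R :=
  if s == 0 then \d_m A else normal_prob m s A.

(* Every linear combination of the coordinates is univariate Gaussian, possibly
   degenerate, so that singular covariance matrices are allowed. *)
Definition gaussian_vector (d : measure_display) (T : measurableType d)
    (R : realType) (P : probability T R) (k : nat)
    (X : {RV P >-> k.-tuple R}) : Prop :=
  forall c : 'I_k -> R, exists m s : R, 0 <= s /\
    forall A : set R, measurable A ->
      P ((fun w => \sum_(i < k) c i * tnth (X w) i) @^-1` A)
      = gaussian_law m s A.

Definition zero_mean (d : measure_display) (T : measurableType d)
    (R : realType) (P : probability T R) (k : nat)
    (X : {RV P >-> k.-tuple R}) : Prop :=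
  forall i : 'I_k, ('E_P[fun w => tnth (X w) i] = 0)%E.

Definition has_covariance_mx (d : measure_display) (T : measurableType d)
    (R : realType) (P : probability T R) (k : nat)
    (X : {RV P >-> k.-tuple R}) (S : 'M[R]_k) : Prop :=
  forall i j : 'I_k,
    covariance P (fun w => tnth (X w) i) (fun w => tnth (X w) j) = (S i j)%:E.

Definition mutually_independent (d d' : measure_display) (T : measurableType d)
    (T' : measurableType d') (R : realType) (P : probability T R) (I : finType)
    (X : I -> {RV P >-> T'}) : Prop :=
  forall (J : {set I}) (B : I -> set T'), (forall n, measurable (B n)) ->
    P (\bigcap_(n in [set` J]) (X n @^-1` B n))
    = (\prod_(n in J) P (X n @^-1` B n))%E.

Definition identically_distributed (d d' : measure_display)
    (T : measurableType d) (T' : measurableType d') (R : realType)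
    (P : probability T R) (I : finType) (X : I -> {RV P >-> T'}) : Prop :=
  forall (m n : I) (B : set T'), measurable B ->
    distribution P (X m) B = distribution P (X n) B.

Definition has_pdf (d : measure_display) (T : measurableType d)
    (R : realType) (P : probability T R) (X : T -> R) (f : R -> R) : Prop :=
  [/\ measurable_fun setT X, measurable_fun setT f, (forall x, 0 <= f x) &
      forall A : set R, measurable A ->
        P (X @^-1` A) = (\int[lebesgue_measure]_(x in A) (f x)%:E)%E].

Definition Gamma (R : realType) (a : R) : R :=
  Rintegral lebesgue_measure `]0, +oo[ (fun t => t `^ (a - 1) * expR (- t)).

(* Square root of the average, over the N samples, of half the sum of squares of
   coordinates i and q. Coordinates are numbered from 0, in the order
   I_1, Q_1, I_2, Q_2. *)
Definition sigma_hat (d : measure_display) (T : measurableType d)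
    (R : realType) (P : probability T R) (N : nat)
    (x : 'I_N -> {RV P >-> 4.-tuple R}) (i q : 'I_4) (w : T) : R :=
  Num.sqrt ((2 * N%:R)^-1 *
            \sum_(n < N) (tnth (x n w) i ^+ 2 + tnth (x n w) q ^+ 2)).

Definition sigma_hat1 (d : measure_display) (T : measurableType d)
    (R : realType) (P : probability T R) (N : nat)
    (x : 'I_N -> {RV P >-> 4.-tuple R}) : T -> R :=
  sigma_hat x (@Ordinal 4 0 isT) (@Ordinal 4 1 isT).

Definition sigma_hat2 (d : measure_display) (T : measurableType d)
    (R : realType) (P : probability T R) (N : nat)
    (x : 'I_N -> {RV P >-> 4.-tuple R}) : T -> R :=
  sigma_hat x (@Ordinal 4 2 isT) (@Ordinal 4 3 isT).

Definition sigma_hat_pdf (R : realType) (N : nat) (sigma x : R) : R :=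
  if 0 <= x then
    2 * N%:R ^+ N / (Gamma N%:R * sigma ^+ (2 * N)) * x ^+ (2 * N - 1)
      * expR (- (N%:R * x ^+ 2 / sigma ^+ 2))
  else 0.

(* Main.v *)
Require Import Defs.
From HB Require Import structures.
From mathcomp Require Import all_boot all_order all_algebra.
From mathcomp Require Import all_classical all_reals all_analysis.
From mathcomp Require Import measurable_realfun ring lra.

(* Fix a channel with coordinates I and Q and write v = sigma^2. Every aI + bQ is
   centred Gaussian with variance (a^2 + b^2) v. If g1 and g2 are independent
   N(0, 2l), then E cos(g1 a + g2 b) = exp (- l (a^2 + b^2)), so exchanging the
   two expectations gives E exp (- l (I^2 + Q^2)) = 1 / (1 + 2 l v); working with
   1 + cos instead of cos keeps every integrand nonnegative, and Tonelli suffices.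
   By independence the square of the estimator has Laplace transform
   (1 + l v / N)^-N. The claimed density gives x^2 the same transform, and Laplace
   transforms determine laws on [0, +oo[: the expectations of
   (1 - exp (- s U))^m agree, and for m close to e^(s c), as s grows, they
   squeeze the tail probabilities of U beyond c. *)

Set Implicit Arguments.
Unset Strict Implicit.
Unset Printing Implicit Defensive.
Import Order.TTheory GRing.Theory Num.Theory.
Import numFieldNormedType.Exports HBNNSimple.
Local Open Scope classical_set_scope.
Local Open Scope ring_scope.

(** [gaussian_vector] speaks only of the laws of linear combinations, one at a time: neither a joint
    density of (I, Q) nor the independence of I and Q is directly available, and deriving them from
    zero covariance would call for uniqueness of characteristic functions in the plane. Random
    frequencies sidestep this: exp (- l Q^2) is a mixture of cosines of multiples of Q, so the
    exponential of I^2 + Q^2 is reached through expectations of functions of single linear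
    combinations. Real cosines with a phase take the place of complex exponentials. The square of
    the estimator is the quantity to transform because it is a sum over samples: its exponential is
    a product, which independence turns into an N-th power, and no convolution of densities is
    computed. The constants match because the integral of x^(2N-1) exp (- a x^2) over the half-line
    is Gamma(N) / (2 a^N). *)

Section transfer.
Context d d' (T : measurableType d) (T' : measurableType d') (R : realType).
Variables (mu : {measure set T -> \bar R}) (nu : {measure set T' -> \bar R}).
Variables (G : T -> R) (X : T -> T') (c : R).
Hypothesis mG : measurable_fun setT G.
Hypothesis G0 : forall x, 0 <= G x.
Hypothesis mX : measurable_fun setT X.
Hypothesis dens : forall B, measurable B ->
  (\int[mu]_(x in X @^-1` B) (G x)%:E = c%:E * nu B)%E.

(** The formula is linear in [f] and stable under increasing limits, and [dens] is the case of an
    indicator, so simple functions and monotone convergence suffice. It serves with [X] the identity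
    to integrate against a law given by a density, with [G] equal to 1 for a change of variables,
    and with [G] a partial product in the independence argument. *)
Lemma ge0_integral_transfer (f : T' -> R) : measurable_fun setT f ->
  (forall y, 0 <= f y) ->
  (\int[mu]_x (G x * f (X x))%:E = c%:E * \int[nu]_y (f y)%:E)%E.
Proof.
move=> mf f0.
have mEf : measurable_fun setT (EFin \o f) by exact/measurable_EFinP.
have mB B : measurable B -> measurable (X @^-1` B).
  by move=> mB; rewrite -[_ @^-1` _]setTI; exact: mX.
pose f_ := nnsfun_approx measurableT mEf.
have cvf y : (f_ n y)%:E @[n --> \oo] --> (f y)%:E.
  by apply: (@cvg_nnsfun_approx _ _ _ _ measurableT _ mEf) => // ? _; rewrite lee_fin.
have mfX n : measurable_fun setT (fun x => f_ n (X x)).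
  by apply: measurableT_comp => //; exact: measurable_funP.
have step n : (\int[mu]_x (G x * f_ n (X x))%:E =
               c%:E * \int[nu]_y (f_ n y)%:E)%E.
  under eq_integral do rewrite fimfunE mulr_fsumr// -fsumEFin//.
  under [in RHS]eq_integral do rewrite fimfunE -fsumEFin//.
  rewrite ge0_integral_fsum//; last 2 first.
  - move=> r; apply/measurable_EFinP/measurable_funM => //.
    apply: measurable_funM => //.
    have -> : (fun x => \1_(f_ n @^-1` [set r]) (X x)) = \1_(X @^-1` (f_ n @^-1` [set r])) :> (T -> R).
      by apply/funext => x; rewrite !indicE.
    by apply: measurable_indic; exact: mB.
  - by move=> r x _; rewrite EFinM mule_ge0// ?lee_fin// -lee_fin EFinM nnfun_muleindic_ge0.
  rewrite ge0_integral_fsum//; last 2 first.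
  - by move=> y; exact/measurable_EFinP/measurable_funM.
  - by move=> y x _; rewrite nnfun_muleindic_ge0.
  rewrite ge0_mule_fsumr; last first.
    by move=> r; apply: integral_ge0 => y _; rewrite nnfun_muleindic_ge0.
  apply: eq_fsbigr => r rf.
  have r0 : 0 <= r by move: rf; rewrite inE => -[y _ <-].
  rewrite integralZl_indic_nnsfun// integral_indic//= setIT.
  transitivity (r%:E * \int[mu]_(x in X @^-1` (f_ n @^-1` [set r])) (G x)%:E)%E.
    rewrite -ge0_integralZl//=; last 3 first.
    - exact: mB.
    - by apply: measurable_funTS; exact/measurable_EFinP.
    - by move=> x _; rewrite lee_fin.
    rewrite [in RHS]integral_mkcond.
    apply: eq_integral => x _; rewrite patchE indicE -EFinM.
    rewrite (_ : (X x \in f_ n @^-1` [set r]) = (x \in X @^-1` (f_ n @^-1` [set r])))//.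
    by case: ifP => _; rewrite ?mulr1 ?mulr0 ?mule0// -?EFinM mulrC.
  by rewrite dens// muleCA.
transitivity (limn (fun n => \int[mu]_x (G x * f_ n (X x))%:E))%E.
  rewrite -monotone_convergence//.
  - apply: eq_integral => y _; apply/esym/cvg_lim => //.
    under eq_fun do rewrite EFinM.
    by rewrite EFinM; apply: cvgeZl => //; exact: cvf.
  - by move=> n; apply/measurable_EFinP/measurable_funM.
  - by move=> n y _; rewrite lee_fin mulr_ge0.
  - move=> y _ m n mn; rewrite lee_fin ler_wpM2l//; exact/lefP/nd_nnsfun_approx.
rewrite (_ : (fun n => _) = (fun n => c%:E * \int[nu]_y (f_ n y)%:E))%E; last exact/funext.
have cvi : (\int[nu]_y (f_ n y)%:E)%E @[n --> \oo] --> (\int[nu]_y (f y)%:E)%E.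
  rewrite (_ : (\int[nu]_y (f y)%:E = \int[nu]_y limn (fun n => (f_ n y)%:E))%E).
    apply: cvg_monotone_convergence => //.
    - by move=> n; apply/measurable_EFinP.
    - by move=> n y _; rewrite lee_fin.
    - by move=> y _ m n mn; rewrite lee_fin; exact/lefP/nd_nnsfun_approx.
  by apply: eq_integral => y _; apply/esym/cvg_lim => //; exact: cvf.
by apply/cvg_lim => //; apply: cvgeZl.
Qed.

End transfer.

Lemma bounded_integrable d (T : measurableType d) (R : realType)
    (P : probability T R) (f : T -> R) (C : R) :
  measurable_fun setT f -> (forall x, `|f x| <= C) ->
  P.-integrable setT (EFin \o f).
Proof.
move=> mf fC; apply: measurable_bounded_integrable => //.
  by rewrite (le_lt_trans (probability_le1 P _)) ?ltry.
exists C; split; first exact: num_real.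
by move=> x Cx y _; exact: le_trans (ltW Cx).
Qed.

Lemma measurable_expR_comp d (T : measurableType d) (R : realType) (U : T -> R) (l : R) :
  measurable_fun setT U -> measurable_fun setT (fun x => expR (- (l * U x))).
Proof.
by move=> mU; apply: measurableT_comp => //; apply: measurableT_comp => //; exact: measurable_funM.
Qed.

(** * Laplace transforms determine laws on the half-line *)

Section laplace_transform.
Context d (T : measurableType d) (R : realType) (P : probability T R).
Variable U : T -> R.
Hypothesis mU : measurable_fun setT U.
Hypothesis U0 : forall x, 0 <= U x.

(* For l = 0 and m close to e^(s c), with s large, this is a smooth version of
   the indicator of u > c. *)
Definition laplace_bump (s : R) (m : nat) (l : R) (u : R) : R :=
  (1 - expR (- (s * u))) ^+ m * expR (- (l * u)).

Lemma measurable_laplace_bump s m l :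
  measurable_fun setT (fun x => laplace_bump s m l (U x)).
Proof.
apply: measurable_funM; last exact: measurable_expR_comp.
apply: measurable_funX; apply: measurable_funB => //; exact: measurable_expR_comp.
Qed.

Lemma laplace_bump01 s m l u : 0 <= s -> 0 <= l -> 0 <= u ->
  0 <= laplace_bump s m l u <= 1.
Proof.
move=> s0 l0 u0.
have q1 : expR (- (s * u)) <= 1 by rewrite expR_le1 oppr_le0 mulr_ge0.
have q2 : expR (- (l * u)) <= 1 by rewrite expR_le1 oppr_le0 mulr_ge0.
have p0 : 0 <= 1 - expR (- (s * u)) by rewrite subr_ge0.
have p1 : 1 - expR (- (s * u)) <= 1 by rewrite gerBl expR_ge0.
rewrite /laplace_bump mulr_ge0 ?exprn_ge0 ?expR_ge0//=.
by rewrite mulr_ile1 ?exprn_ge0 ?expR_ge0// exprn_ile1.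
Qed.

Lemma integrable_laplace_bump s m l : 0 <= s -> 0 <= l ->
  P.-integrable setT (fun x => (laplace_bump s m l (U x))%:E).
Proof.
move=> s0 l0; apply: (@bounded_integrable _ _ _ _ _ 1).
  exact: measurable_laplace_bump.
move=> x; have /andP[b0 b1] := laplace_bump01 m s0 l0 (U0 x).
by rewrite ger0_norm.
Qed.

(** The factor gained, 1 - exp (- s u), splits into two terms, the second of which is absorbed by
    raising [l] to [l + s]. This closure is the reason for carrying [l]: a bump is a finite
    combination of Laplace kernels. *)
Lemma laplace_bumpS s m l u :
  laplace_bump s m.+1 l u = laplace_bump s m l u - laplace_bump s m (l + s) u.
Proof.
rewrite /laplace_bump mulrDl opprD expRD exprS; ring.
Qed.

End laplace_transform.

Section laplace_uniqueness.
Context d1 d2 (T1 : measurableType d1) (T2 : measurableType d2) (R : realType).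
Variables (P : probability T1 R) (Q : probability T2 R) (U : T1 -> R) (V : T2 -> R).
Hypothesis mU : measurable_fun setT U.
Hypothesis mV : measurable_fun setT V.
Hypothesis U0 : forall x, 0 <= U x.
Hypothesis V0 : forall x, 0 <= V x.
Hypothesis UV : forall l, 0 < l ->
  (\int[P]_x (expR (- (l * U x)))%:E = \int[Q]_x (expR (- (l * V x)))%:E)%E.

(** Induction on [m] with [l] free, through [laplace_bumpS]; bumps are bounded, so their integrals
    may be subtracted. The start [l = 0] lies outside [UV] and amounts to both total masses being
    1. *)
Lemma integral_laplace_bump_eq s m l : 0 < s -> 0 <= l ->
  (\int[P]_x (laplace_bump s m l (U x))%:E =
   \int[Q]_x (laplace_bump s m l (V x))%:E)%E.
Proof.
move=> s0; elim: m l => [|m IH] l l0.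
  have [->|l_neq0] := eqVneq l 0; last first.
    rewrite /laplace_bump; under eq_integral do rewrite expr0 mul1r.
    under [RHS]eq_integral do rewrite expr0 mul1r.
    by apply: UV; rewrite lt0r l_neq0.
  rewrite /laplace_bump; under eq_integral do rewrite expr0 mul1r mul0r oppr0 expR0.
  under [RHS]eq_integral do rewrite expr0 mul1r mul0r oppr0 expR0.
  rewrite !integral_cst// !mul1e.
  by transitivity (1%E : \bar R); [exact: probability_setT|apply/esym; exact: probability_setT].
under eq_integral do rewrite laplace_bumpS EFinB.
under [RHS]eq_integral do rewrite laplace_bumpS EFinB.
have s0' := ltW s0; have ls0 : 0 <= l + s by rewrite addr_ge0.
by rewrite !integralB//; [rewrite !IH|exact: integrable_laplace_bump..].
Qed.

End laplace_uniqueness.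

(** The bump behaves like exp (- m exp (- s u)), whose transition near u = ln m / s sharpens as [s]
    grows. Bernoulli's inequality bounds it below to the right of [w], and 1 - q <= exp (- q) bounds
    it above to the left of [v]. *)
Lemma laplace_bump_step (R : realType) (v w e : R) : 0 <= v -> v < w -> 0 < e ->
  exists s m, [/\ 0 < s,
    forall u, w < u -> 1 - e <= laplace_bump s m 0 u &
    forall u, 0 <= u -> u <= v -> laplace_bump s m 0 u <= e].
Proof.
move=> v0 vw e0.
(* This makes e s (w - v) equal to 1/e + 1, so that e exp (s (w - v)) is at least 1/e + 1; the
   summand 1 pays for rounding [y] down to [m]. *)
pose s := (e^-1 + 1) / (e * (w - v)).
have wv0 : 0 < w - v by rewrite subr_gt0.
have s0 : 0 < s by rewrite divr_gt0 ?addr_gt0 ?invr_gt0 ?mulr_gt0.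
(* Chosen so that y exp (- s w) = e: beyond [w] the Bernoulli loss m exp (- s u) is then at most
   [e]. *)
pose y := e * expR (s * w).
have y0 : 0 <= y by rewrite mulr_ge0 ?expR_ge0 ?ltW.
pose m := Num.truncn y.
have my : m%:R <= y by rewrite truncn_le.
have ym : y <= m%:R + 1 by rewrite natr1; apply/ltW; exact: truncnS_gt.
exists s, m; split => //.
- move=> u wu; rewrite /laplace_bump mul0r oppr0 expR0 mulr1.
  have u0 : 0 < u by rewrite (lt_trans _ wu)// (le_lt_trans v0).
  have q1 : expR (- (s * u)) <= 1 by rewrite expR_le1 oppr_le0 mulr_ge0 // ltW.
  have bern k (q : R) : 0 <= q -> q <= 1 -> 1 - k%:R * q <= (1 - q) ^+ k.
    move=> q0 q1'; elim: k => [|k IHk]; first by rewrite mul0r subr0 expr0.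
    rewrite exprS; apply: (le_trans _ (ler_wpM2l _ IHk)); last by rewrite subr_ge0.
    rewrite -natr1; have : 0 <= k%:R * q * q by rewrite !mulr_ge0.
    lra.
  apply: le_trans (bern m _ (expR_ge0 _) q1).
  rewrite lerB//.
  apply: (@le_trans _ _ (y * expR (- (s * w)))).
    by rewrite ler_pM ?expR_ge0// ler_expR lerN2 ler_pM2l// ltW.
  by rewrite /y -mulrA -expRD subrr expR0 mulr1.
- move=> u u0 uv; rewrite /laplace_bump mul0r oppr0 expR0 mulr1.
  have q1 : 1 - expR (- (s * u)) <= expR (- expR (- (s * v))).
    apply: le_trans (expR_ge1Dx _); rewrite lerD2l lerN2 ler_expR lerN2.
    by rewrite ler_pM2l.
  apply: (@le_trans _ _ (expR (- expR (- (s * v))) ^+ m)).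
    apply: lerXn2r; rewrite ?nnegrE ?expR_ge0// subr_ge0 expR_le1 oppr_le0.
    by rewrite mulr_ge0// ltW.
  rewrite -expRM_natl mulrN expRN.
  rewrite -[leRHS]invrK lef_pV2 ?posrE ?invr_gt0 ?expR_gt0//.
  apply: (le_trans _ (expR_ge1Dx _)).
  have h1 : (y - 1) * expR (- (s * v)) <= m%:R * expR (- (s * v)).
    by rewrite ler_wpM2r ?expR_ge0// lerBlDr.
  have h2 : expR (- (s * v)) <= 1 by rewrite expR_le1 oppr_le0 mulr_ge0// ltW.
  have h3 : y * expR (- (s * v)) = e * expR (s * (w - v)).
    by rewrite /y -mulrA -expRD; congr (_ * expR _); ring.
  have h4 : e^-1 + 1 <= y * expR (- (s * v)).
    rewrite h3; apply: (@le_trans _ _ (e * (s * (w - v)))).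
      by rewrite /s le_eqVlt; apply/orP; left; apply/eqP; field; rewrite !gt_eqF.
    rewrite ler_pM2l//; apply: (le_trans _ (expR_ge1Dx _)); lra.
  lra.
Qed.

Section laplace_law.
Context d1 d2 (T1 : measurableType d1) (T2 : measurableType d2) (R : realType).
Variables (P : probability T1 R) (Q : probability T2 R) (U : T1 -> R) (V : T2 -> R).
Hypothesis mU : measurable_fun setT U.
Hypothesis mV : measurable_fun setT V.
Hypothesis U0 : forall x, 0 <= U x.
Hypothesis V0 : forall x, 0 <= V x.
Hypothesis UV : forall l, 0 < l ->
  (\int[P]_x (expR (- (l * U x)))%:E = \int[Q]_x (expR (- (l * V x)))%:E)%E.

(** Up to [e], the bump lies above the indicator of ]w, +oo[ and below that of ]v, +oo[; between [v]
    and [w] it is only known to lie in [0, 1], which both comparisons tolerate. Its expectation is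
    common to [U] and [V]. *)
Lemma laplace_tail_le v w : 0 <= v -> v < w ->
  (P (U @^-1` `]w, +oo[) <= Q (V @^-1` `]v, +oo[))%E.
Proof.
move=> v0 vw; apply/lee_addgt0Pr => e2 e20.
pose e := e2 / 2; have e0 : 0 < e by rewrite divr_gt0.
have [s [m [s0 hi lo]]] := laplace_bump_step v0 vw e0.
have mA : measurable (U @^-1` `]w, +oo[) by rewrite -[_ @^-1` _]setTI; exact: mU.
have mB : measurable (V @^-1` `]v, +oo[) by rewrite -[_ @^-1` _]setTI; exact: mV.
have s0' := ltW s0.
have addcst d (T : measurableType d) (p : probability T R) (f : T -> R) :
    measurable_fun setT f -> (forall x, 0 <= f x) ->
    (\int[p]_x (f x + e)%:E = \int[p]_x (f x)%:E + e%:E)%E.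
  move=> mf f0; under eq_integral do rewrite EFinD.
  rewrite ge0_integralD//.
  - rewrite integral_cst//; congr (_ + _)%E; rewrite -[RHS]mule1; congr (_ * _)%E.
    exact: probability_setT.
  - by move=> x _; rewrite lee_fin.
  - exact/measurable_EFinP.
  - by move=> x _; rewrite lee_fin ltW.
have PA : (P (U @^-1` `]w, +oo[) = \int[P]_x (\1_(U @^-1` `]w, +oo[) x)%:E)%E.
  by rewrite integral_indic// setIT.
have QB : (Q (V @^-1` `]v, +oo[) = \int[Q]_x (\1_(V @^-1` `]v, +oo[) x)%:E)%E.
  by rewrite integral_indic// setIT.
have mbU := measurable_laplace_bump mU s m 0.
have mbV := measurable_laplace_bump mV s m 0.
have b01 u : 0 <= u -> 0 <= laplace_bump s m 0 u <= 1 by exact: laplace_bump01.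
apply: (@le_trans _ _ (\int[P]_x (laplace_bump s m 0 (U x))%:E + e%:E)%E).
  rewrite -addcst//; last by move=> x; have /andP[] := b01 _ (U0 x).
  rewrite [leLHS]PA.
  apply: ge0_le_integral => //.
  - by apply/measurable_EFinP; exact: measurable_indic.
  - by apply/measurable_EFinP; exact: measurable_funD.
  - move=> x _; rewrite lee_fin indicE.
    have /andP[b0 b1] := b01 _ (U0 x).
    case: (boolP (x \in _)) => [|_]; last by rewrite addr_ge0// ltW.
    by rewrite inE/= in_itv/= andbT => /hi; rewrite lerBlDr.
rewrite (_ : e2%:E = e%:E + e%:E)%E; last by rewrite -EFinD /e -splitr.
rewrite addeA leeD2r// (integral_laplace_bump_eq mU mV U0 V0 UV)//.
rewrite [leRHS](congr1 (fun z => z + e%:E)%E QB) -addcst//.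
apply: ge0_le_integral => //.
- by move=> x _; rewrite lee_fin; have /andP[] := b01 _ (V0 x).
- by exact/measurable_EFinP.
- by apply/measurable_EFinP; apply: measurable_funD => //; exact: measurable_indic.
- move=> x _; rewrite lee_fin indicE.
  have /andP[b0 b1] := b01 _ (V0 x).
  case: (boolP (x \in _)) => [_|]; first by rewrite (le_trans b1)// lerDl ltW.
  by rewrite notin_setE/= in_itv/= andbT => /negP; rewrite -leNgt add0r => /lo; exact.
Qed.

End laplace_law.

Section laplace_law_eq.
Context d1 d2 (T1 : measurableType d1) (T2 : measurableType d2) (R : realType).
Variables (P : probability T1 R) (Q : probability T2 R).
Variables (U : {mfun T1 >-> R}) (V : {mfun T2 >-> R}).
Hypothesis U0 : forall x, 0 <= U x.
Hypothesis V0 : forall x, 0 <= V x.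
Hypothesis UV : forall l, 0 < l ->
  (\int[P]_x (expR (- (l * U x)))%:E = \int[Q]_x (expR (- (l * V x)))%:E)%E.

(** The gap between [v] and [w] closes as [w] decreases to [v], by right continuity of the
    complementary distribution function. Exchanging [U] and [V] gives the reverse inequality. *)
Lemma laplace_ccdf_le v : 0 <= v ->
  (P (U @^-1` `]v, +oo[) <= Q (V @^-1` `]v, +oo[))%E.
Proof.
move=> v0.
have cv := @ccdf_right_continuous _ _ _ P U v.
have lv : lim (ccdf (P := P) U x @[x --> v^'+]) = P (U @^-1` `]v, +oo[).
  by apply/cvg_lim => //; exact: cv.
rewrite -[leLHS]lv; apply: lime_le; first by apply/cvg_ex; eexists; exact: cv.
near=> w; apply: (laplace_tail_le _ _ _ _ UV) => //.
Unshelve. all: by end_near. Qed.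

End laplace_law_eq.

(** Open right rays form a pi-system generating the Borel sets. A ray starting at a negative point
    has mass 1 for both variables, which settles the rays that [laplace_ccdf_le] does not reach. *)
Lemma laplace_law_unique d1 d2 (T1 : measurableType d1)
    (T2 : measurableType d2) (R : realType)
    (P : probability T1 R) (Q : probability T2 R)
    (U : {mfun T1 >-> R}) (V : {mfun T2 >-> R}) :
  (forall x, 0 <= U x) -> (forall x, 0 <= V x) ->
  (forall l, 0 < l ->
    (\int[P]_x (expR (- (l * U x)))%:E = \int[Q]_x (expR (- (l * V x)))%:E)%E) ->
  forall A, measurable A -> P (U @^-1` A) = Q (V @^-1` A).
Proof.
move=> U0 V0 UV A mA.
apply: (@measure_unique _ R _ (@RGenOInfty.G R) (fun n => `](- n%:R), +oo[%classic)
  _ _ _ _ (distribution P U) (distribution Q V)) => //.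
- exact: RGenOInfty.measurableE.
- move=> _ _ [x ->] [y ->]; exists (Num.max x y).
  by apply/seteqP; split => z /=; rewrite !in_itv/= !andbT gt_max => /andP.
- by move=> n; eexists.
- apply/seteqP; split => // x _; exists (Num.truncn `|x|).+1 => //=.
  rewrite in_itv/= andbT ltrNl (le_lt_trans _ (truncnS_gt _))//.
  by rewrite -normrN ler_norm.
- move=> _ [v ->]; rewrite /distribution/= /pushforward.
  have [v0|v0] := leP 0 v.
    by apply/eqP; rewrite eq_le !laplace_ccdf_le// => l l0; rewrite UV.
  have full d (T : measurableType d) (p : probability T R) (W : T -> R) :
      (forall x, 0 <= W x) -> p (W @^-1` `]v, +oo[) = 1%E.
    move=> W0; rewrite (_ : W @^-1` _ = setT); first exact: probability_setT.
    by apply/seteqP; split => // x _ /=; rewrite in_itv/= andbT (lt_le_trans v0).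
  by transitivity (1%E : \bar R); [exact: (full _ _ P U)|apply/esym; exact: (full _ _ Q V)].
- move=> n; apply: (@le_lt_trans _ _ 1%E); last exact: ltry.
  by apply: (probability_le1 (distribution P U)).
Qed.

(** * Expectation of a product of functions of independent variables *)

Section independence.
Context d d' (T : measurableType d) (T' : measurableType d') (R : realType).
Variables (P : probability T R) (I : finType) (X : I -> {RV P >-> T'}).
Variables (f : I -> T' -> R) (e : I -> R).
Hypothesis indep : mutually_independent X.
Hypothesis mf : forall i, measurable_fun setT (f i).
Hypothesis f0 : forall i y, 0 <= f i y.
Hypothesis fe : forall i, (\int[P]_x (f i (X i x))%:E = (e i)%:E)%E.

Let mXpre n C : measurable C -> measurable (X n @^-1` C).
Proof. by move=> mC; rewrite -[_ @^-1` _]setTI; exact: measurable_funP. Qed.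

Lemma measurable_prod_comp (s : seq I) :
  measurable_fun setT (fun x => \prod_(i <- s) f i (X i x)).
Proof.
elim: s => [|i s IH]; first by under eq_fun do rewrite big_nil; exact: measurable_cst.
under eq_fun do rewrite big_cons; apply: measurable_funM => //.
by apply: measurableT_comp => //; exact: measurable_funP.
Qed.

(* The events indexed by J make the induction on s go through: by the induction
   hypothesis, the remaining product is a density turning the law of X i into a
   multiple of itself, and ge0_integral_transfer applies. *)
Lemma integral_prod_bigcap (s : seq I) (J : {set I}) (B : I -> set T') :
  uniq s -> (forall i, i \in s -> i \notin J) -> (forall i, measurable (B i)) ->
  (\int[P]_(x in \bigcap_(n in [set` J]) (X n @^-1` B n))
     (\prod_(i <- s) f i (X i x))%:E
   = (\prod_(i <- s) e i * \prod_(n in J) fine (P (X n @^-1` B n)))%:E)%E.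
Proof.
elim: s J B => [|i s IH] J B.
  move=> _ _ mB; under eq_integral do rewrite big_nil.
  have mcap : measurable (\bigcap_(n in [set` J]) (X n @^-1` B n)).
    apply: fin_bigcap_measurable => // n _.
    by exact: mXpre.
  rewrite integral_cst// mul1e big_nil mul1r -prodEFin.
  apply: (etrans (indep J mB)).
  by apply: eq_bigr => n _; rewrite fineK//; apply: fin_num_measure; exact: mXpre.
move=> /= /andP[nis us] sJ mB.
have mcap (J' : {set I}) B' : (forall n, measurable (B' n)) ->
    measurable (\bigcap_(n in [set` J']) (X n @^-1` B' n)).
  move=> mB'; apply: fin_bigcap_measurable => // n _.
  by exact: mXpre.
have iJ : i \notin J by apply: sJ; rewrite mem_head.
pose E := \bigcap_(n in [set` J]) (X n @^-1` B n).
pose G x : R := \prod_(j <- s) f j (X j x) * \1_E x.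
have G0 x : 0 <= G x by rewrite mulr_ge0// prodr_ge0.
have mG : measurable_fun setT G.
  by apply: measurable_funM; [exact: measurable_prod_comp|apply: measurable_indic; exact: mcap].
pose c := \prod_(j <- s) e j * \prod_(n in J) fine (P (X n @^-1` B n)).
have restrG D : (\int[P]_(x in D) (G x)%:E =
    \int[P]_(x in D `&` E) (\prod_(j <- s) f j (X j x))%:E)%E.
  rewrite integral_mkcondr; apply: eq_integral => x _; rewrite patchE /G indicE.
  by case: ifP => _; rewrite ?mulr1 ?mulr0.
have mXi : measurable_fun setT (X i) by exact: measurable_funP.
have dens C : measurable C ->
    (\int[P]_(x in X i @^-1` C) (G x)%:E = c%:E * distribution P (X i) C)%E.
  move=> mC; rewrite restrG.
  (* Since [i] is outside [J], the event on [X i] joins the family under its own index, and the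
     induction hypothesis applies to [i |: J]. *)
  pose B' n := if n == i then C else B n.
  have mB' n : measurable (B' n) by rewrite /B'; case: ifP.
  have BB n : n \in J -> B' n = B n.
    by rewrite /B'; case: eqP => // ->; rewrite (negbTE iJ).
  have -> : X i @^-1` C `&` E = \bigcap_(n in [set` i |: J]) (X n @^-1` B' n).
    apply/seteqP; split => [x [xC xE] n /=|x xE].
      rewrite !inE => /orP[/eqP ->|nJ]; first by rewrite /B' eqxx.
      by rewrite BB//; exact: xE.
    split.
      by have := xE i; rewrite /B' eqxx; apply; rewrite /= !inE eqxx.
    by move=> n /= nJ; have := xE n; rewrite /= BB//; apply; rewrite !inE nJ orbT.
  rewrite IH//; last first.
    move=> j js; rewrite !inE negb_or; apply/andP; split.
      by apply: contra nis => /eqP <-.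
    by apply: sJ; rewrite inE js orbT.
  rewrite big_setU1//= /B' eqxx.
  rewrite [X in (_ * (_ * X))%:E](_ : _ = \prod_(n in J) fine (P (X n @^-1` B n))); last first.
    by apply: eq_bigr => n nJ; rewrite -/(B' n) BB.
  rewrite mulrCA EFinM muleC /c; congr (_ * _)%E.
  by rewrite fineK//; apply: fin_num_measure; exact: mXpre.
have := ge0_integral_transfer mG G0 mXi dens (mf i) (f0 i).
rewrite ge0_integral_distribution; last 2 first.
- exact/measurable_EFinP.
- by move=> y; rewrite lee_fin.
rewrite fe big_cons -/E => h.
rewrite (_ : _ * _ * _ = c * e i); last by rewrite /c; ring.
rewrite EFinM -h.
rewrite [LHS]integral_mkcond; apply: eq_integral => x _.
rewrite patchE /G indicE big_cons; case: ifP => _.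
  by rewrite mulr1 mulrC.
by rewrite mulr0 mul0r.
Qed.

Lemma independent_integral_prod :
  (\int[P]_x (\prod_(i : I) f i (X i x))%:E = (\prod_(i : I) e i)%:E)%E.
Proof.
have := @integral_prod_bigcap (enum I) finset.set0 (fun=> [set: T']) (enum_uniq I).
rewrite big_set0 mulr1 !big_enum /=.
rewrite (_ : \bigcap_(n in [set` finset.set0]) _ = setT); last first.
  by apply/seteqP; split => // x _ n /=; rewrite inE.
move=> <-//; last by move=> i _; rewrite inE.
by apply: eq_integral => x _; rewrite big_enum.
Qed.

End independence.

(** * Improper integrals by the fundamental theorem of calculus *)

Section ftc_exhaustion.
Context (R : realType).
Local Notation mu := (@lebesgue_measure R).
Variables (F f g : R -> R) (a : nat -> R) (l : R).
Hypothesis dF : forall x, is_derive x (1 : R) F (f x - g x).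
Hypothesis cf : continuous f.
Hypothesis cg : continuous g.
Hypothesis a0 : forall n, a n <= 0.
Hypothesis nia : nonincreasing_seq a.

Lemma integral_ftc_itv n :
  (\int[mu]_(x in `[a n, n.+1%:R]) (f x)%:E =
   \int[mu]_(x in `[a n, n.+1%:R]) (g x)%:E + (F n.+1%:R - F (a n))%:E)%E.
Proof.
have ab : a n < n.+1%:R by rewrite (le_lt_trans (a0 n)).
have itg (h : R -> R) : continuous h -> mu.-integrable `[a n, n.+1%:R] (EFin \o h).
  move=> ch; apply: continuous_compact_integrable; first exact: segment_compact.
  exact: continuous_subspaceT.
have cfg : continuous (fun x => f x - g x).
  by move=> x; apply: cvgB; [exact: cf|exact: cg].
have cF : continuous F.
  by move=> x; apply/differentiable_continuous/derivable1_diffP; have [] := dF x.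
rewrite EFinB -(@continuous_FTC2 _ (fun x => f x - g x) F _ _ ab).
- rewrite -integralD//; [|exact: itg..].
  by apply: eq_integral => x _ /=; rewrite -EFinD addrC subrK.
- exact: continuous_subspaceT.
- split; first by move=> x _; have [] := dF x.
  + by apply: cvg_at_right_filter; exact: cF.
  + by apply: cvg_at_left_filter; exact: cF.
- by move=> x _; rewrite derive1E; have [_] := dF x.
Qed.

Hypothesis f0 : forall x, (exists n, a n <= x) -> 0 <= f x.
Hypothesis g0 : forall x, (exists n, a n <= x) -> 0 <= g x.
Hypothesis Fl : F n.+1%:R - F (a n) @[n --> \oo] --> l.

(** With F' = f - g this is integration by parts on growing intervals. Nonnegativity turns both
    integrals into monotone limits, so neither has to be known finite beforehand; only the boundary
    term has to converge. The left end [a n] is - (n + 1) for the whole line and 0 for the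
    half-line. *)
Lemma ge0_integral_ftc_exhaustion :
  (\int[mu]_(x in \bigcup_n `[a n, n.+1%:R]%classic) (f x)%:E =
   \int[mu]_(x in \bigcup_n `[a n, n.+1%:R]%classic) (g x)%:E + l%:E)%E.
Proof.
have cvi (h : R -> R) : continuous h ->
    (forall x, (exists n, a n <= x) -> 0 <= h x) ->
    (\int[mu]_(x in `[a n, n.+1%:R]) (h x)%:E)%E @[n --> \oo] -->
    (\int[mu]_(x in \bigcup_n `[a n, n.+1%:R]%classic) (h x)%:E)%E.
  move=> ch h0.
  apply: (@ge0_nondecreasing_set_cvg_integral _ (measurableTypeR R) R
    (fun n => `[a n, n.+1%:R]%classic) (EFin \o h) mu).
  - move=> m n mn; apply/subsetPset => x /=; rewrite !in_itv/= => /andP[ax xn].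
    by rewrite (le_trans (nia mn))// (le_trans xn)// ler_nat ltnS.
  - by move=> n; exact: measurable_itv.
  - move=> n; apply/measurable_EFinP; apply: measurable_funTS.
    exact: continuous_measurable_fun.
  - move=> n x /=; rewrite in_itv/= => /andP[ax _]; rewrite lee_fin.
    by apply: h0 => //; exists n.
have := cvi f cf f0; under eq_fun do rewrite integral_ftc_itv.
move=> /(cvg_lim (@ereal_hausdorff R)) <-.
apply: cvg_lim => //; apply: cvgeD; first by rewrite fin_num_adde_defl.
  exact: cvi.
by apply: cvg_EFin; [exact: nearW|exact: Fl].
Qed.

End ftc_exhaustion.

Lemma ge0_integralT_ftc (R : realType) (F f g : R -> R) (l : R) :
  (forall x, is_derive x (1 : R) F (f x - g x)) ->
  continuous f -> continuous g -> (forall x, 0 <= f x) -> (forall x, 0 <= g x) ->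
  F n.+1%:R - F (- n.+1%:R) @[n --> \oo] --> l ->
  (\int[lebesgue_measure]_x (f x)%:E =
   \int[lebesgue_measure]_x (g x)%:E + l%:E)%E.
Proof.
move=> dF cf cg f0 g0 Fl.
have -> : [set: R] = \bigcup_n `[(- n.+1%:R : R), n.+1%:R]%classic.
  apply/seteqP; split => // x _; exists (Num.truncn `|x|) => //=.
  rewrite in_itv/= lerNl.
  have xn := ltW (truncnS_gt `|x|).
  by rewrite (le_trans _ xn) ?(le_trans (ler_norm _) xn)// -normrN ler_norm.
apply: (@ge0_integral_ftc_exhaustion _ F f g (fun n => - n.+1%:R)) => //.
- by move=> m n mn; rewrite lerN2 ler_nat ltnS.
Qed.

Lemma ge0_integral0y_ftc (R : realType) (F f g : R -> R) (l : R) :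
  (forall x, is_derive x (1 : R) F (f x - g x)) ->
  continuous f -> continuous g ->
  (forall x, 0 <= x -> 0 <= f x) -> (forall x, 0 <= x -> 0 <= g x) ->
  F n.+1%:R - F 0 @[n --> \oo] --> l ->
  (\int[lebesgue_measure]_(x in `[0%R, +oo[) (f x)%:E =
   \int[lebesgue_measure]_(x in `[0%R, +oo[) (g x)%:E + l%:E)%E.
Proof.
move=> dF cf cg f0 g0 Fl.
have -> : `[(0 : R), +oo[%classic = \bigcup_n `[(0 : R), n.+1%:R]%classic.
  apply/seteqP; split => [x/=|x [n _] /=]; rewrite !in_itv/= ?andbT.
    move=> x0; exists (Num.truncn `|x|) => //=; rewrite in_itv/= x0/=.
    by rewrite (le_trans (ler_norm x))// ltW// truncnS_gt.
  by move=> /andP[].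
by apply: (@ge0_integral_ftc_exhaustion _ F f g (fun=> 0)) => //;
  [move=> x [_]; exact: f0|move=> x [_]; exact: g0].
Qed.

Lemma norm_sin_le1 (R : realType) (x : R) : `|sin x| <= 1.
Proof. by rewrite ler_norml sin_geN1 sin_le1. Qed.

Lemma norm_cos_le1 (R : realType) (x : R) : `|cos x| <= 1.
Proof. by rewrite ler_norml cos_geN1 cos_le1. Qed.

Lemma norm_le_1Dsqr (R : realType) (x : R) : `|x| <= 1 + x ^+ 2.
Proof.
have -> : x ^+ 2 = `|x| ^+ 2 by rewrite real_normK// num_real.
by have := sqr_ge0 (`|x| - 1); nra.
Qed.

Lemma derivable_continuous (R : realType) (h : R -> R) :
  (forall x, derivable h x (1 : R)) -> continuous h.
Proof. by move=> dh x; apply/differentiable_continuous/derivable1_diffP. Qed.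

(** [F] decays at least like C / |x - m|, hence vanishes at each end separately. *)
Lemma cvg_symmetric_diff0 (R : realType) (F : R -> R) (m C : R) :
  (forall x, `|F x| * `|x - m| <= C) ->
  F n.+1%:R - F (- n.+1%:R) @[n --> \oo] --> 0.
Proof.
move=> FC.
have C0 : 0 <= C by apply: le_trans (FC 0); rewrite mulr_ge0.
apply/cvgrPdist_le => e e0.
(* Past this threshold |x - m| is at least 2 C / e + 1; the summand 1 keeps the contradiction
   strict, in particular when [C] is 0. *)
have Fe x : `|m| + (2 * C / e + 1) <= `|x| -> `|F x| <= e / 2.
  move=> mx; have h1 : 2 * C / e + 1 <= `|x - m|.
    by have := lerB_dist x m; lra.
  have h2 : 0 <= 2 * C / e by rewrite divr_ge0 ?mulr_ge0// ltW.
  have h3 : e * (2 * C / e) = 2 * C by field; rewrite gt_eqF.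
  have := FC x; have := normr_ge0 (F x); move: (`|F x|) (`|x - m|) h1 => p q h1 p0 h4.
  rewrite leNgt; apply/negP => ep.
  have h5 : p * (2 * C / e + 1) <= p * q by rewrite ler_wpM2l.
  have h6 : e / 2 * (2 * C / e + 1) < p * (2 * C / e + 1).
    by rewrite ltr_pM2r//; lra.
  lra.
near=> n.
have nb : `|m| + (2 * C / e + 1) <= n.+1%:R.
  near: n; exists (Num.truncn (`|m| + (2 * C / e + 1))) => // k /= kn.
  by rewrite (le_trans (ltW (truncnS_gt _)))// ler_nat ltnS.
rewrite sub0r normrN (le_trans (ler_normB _ _))// (splitr e) lerD//; apply: Fe.
  by rewrite [leRHS]ger0_norm.
by rewrite normrN [leRHS]ger0_norm.
Unshelve. all: end_near. Qed.

(** * Decay and second moment of the normal density *)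

Section normal_integrals.
Context (R : realType).
Local Notation mu := (@lebesgue_measure R).
Variables (m s : R).
Hypothesis s0 : s != 0.

Lemma is_derive_normal_pdf (x : R) :
  is_derive x (1 : R) (normal_pdf m s) (- ((x - m) / s ^+ 2) * normal_pdf m s x).
Proof.
rewrite normal_pdfE// /normal_fun.
apply: is_derive_eq.
by rewrite /GRing.scale/=; field; rewrite s0.
Qed.

(** In terms of y = (x - m)^2 / (2 s^2) the bound reads 1 + 2 s^2 y <= (1 + 2 s^2) exp y, a
    consequence of 1 + y <= exp y. *)
Lemma normal_pdf_decay x : (1 + (x - m) ^+ 2) * normal_pdf m s x <=
  (1 + 2 * s ^+ 2) * normal_peak s.
Proof.
rewrite normal_pdfE// mulrCA [leRHS]mulrC ler_wpM2l ?normal_peak_ge0//.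
rewrite /normal_fun mulNr expRN mulr_natl.
have s2 : 0 < s ^+ 2 *+ 2 by rewrite pmulrn_lgt0// exprn_even_gt0.
set y := (x - m) ^+ 2 / (s ^+ 2 *+ 2).
have y0 : 0 <= y by rewrite divr_ge0 ?sqr_ge0// ltW.
have -> : (x - m) ^+ 2 = (s ^+ 2 *+ 2) * y.
  by rewrite /y mulrC divfK// gt_eqF.
rewrite ler_pdivrMr ?expR_gt0//.
apply: (@le_trans _ _ ((1 + s ^+ 2 *+ 2) * (1 + y))).
  by have := mulr_ge0 (ltW s2) y0; lra.
by rewrite ler_wpM2l ?expR_ge1Dx// addr_ge0// ltW.
Qed.

End normal_integrals.

Section normal_second_moment.
Context (R : realType).
Local Notation mu := (@lebesgue_measure R).
Variables (m s : R).
Hypothesis s0 : s != 0.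

(** The boundary terms below are affine functions, or bounded ones, times the density; this is the
    decay that [cvg_symmetric_diff0] asks of them. *)
Lemma normal_pdf_affine_decay (a b x : R) :
  `|(a + b * (x - m)) * normal_pdf m s x| * `|x - m| <=
  (`|a| + `|b|) * ((1 + 2 * s ^+ 2) * normal_peak s).
Proof.
have p0 := normal_pdf_ge0 m s x.
rewrite normrM (ger0_norm p0) mulrAC.
apply: (@le_trans _ _ ((`|a| + `|b|) * (1 + (x - m) ^+ 2) * normal_pdf m s x)).
  rewrite ler_wpM2r//.
  have z2 : (x - m) ^+ 2 = `|x - m| ^+ 2 by rewrite real_normK// num_real.
  have z1 := norm_le_1Dsqr (x - m).
  apply: (@le_trans _ _ ((`|a| + `|b| * `|x - m|) * `|x - m|)).
    by rewrite ler_wpM2r// (le_trans (ler_normD _ _))// normrM.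
  have := ler_wpM2l (normr_ge0 a) z1.
  have := normr_ge0 b; rewrite z2; nra.
by rewrite -mulrA ler_wpM2l ?addr_ge0// normal_pdf_decay.
Qed.

Lemma continuous_mul_normal_pdf (h : R -> R) : continuous h ->
  continuous (fun x => h x * normal_pdf m s x).
Proof. by move=> ch x; apply: cvgM; [exact: ch|exact: continuous_normal_pdf]. Qed.

Lemma integral_normal_sqr (a : R) :
  (\int[mu]_x ((x - a) ^+ 2 * normal_pdf m s x)%:E =
   ((m - a) ^+ 2 + s ^+ 2)%:E)%E.
Proof.
have dp := is_derive_normal_pdf m s0.
(* Since p' = - (x - m) p / s^2 for the density p, the two summands of [F] differentiate to 2 (m -
   a) (x - m) p and ((x - m)^2 - s^2) p, whose sum is ((x - a)^2 - k) p. *)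
pose F (x : R) := (- (2 * s ^+ 2 * (m - a)) + - s ^+ 2 * (x - m)) * normal_pdf m s x.
pose k := (m - a) ^+ 2 + s ^+ 2.
have dF (x : R) : is_derive x (1 : R) F
    ((x - a) ^+ 2 * normal_pdf m s x - k * normal_pdf m s x).
  rewrite /F; apply: is_derive_eq.
  by rewrite /GRing.scale/= /k; field; rewrite s0.
rewrite (ge0_integralT_ftc dF (l := 0)).
- rewrite adde0; under eq_integral do rewrite EFinM.
  rewrite integralZl//; last exact: integrable_normal_pdf.
  by rewrite integral_normal_pdf mule1.
- by apply: continuous_mul_normal_pdf; apply: derivable_continuous => x.
- by apply: continuous_mul_normal_pdf; apply: derivable_continuous => x.
- by move=> x; rewrite mulr_ge0 ?sqr_ge0 ?normal_pdf_ge0.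
- by move=> x; rewrite mulr_ge0 ?normal_pdf_ge0// addr_ge0 ?sqr_ge0.
- by apply: cvg_symmetric_diff0 => x; exact: normal_pdf_affine_decay.
Qed.

End normal_second_moment.

Section normal_cos.
Context (R : realType).
Local Notation mu := (@lebesgue_measure R).
Variables (s : R).
Hypothesis s0 : s != 0.
Local Notation p := (normal_pdf 0 s).

Lemma integrable_normal_1Dsqr :
  mu.-integrable setT (fun x : R => ((1 + x ^+ 2) * p x)%:E).
Proof.
have -> : (fun x : R => ((1 + x ^+ 2) * p x)%:E) =
    (fun x : R => (p x)%:E + (x ^+ 2 * p x)%:E)%E.
  by apply/funext => x; rewrite mulrDl mul1r EFinD.
apply: integrableD => //; first exact: integrable_normal_pdf.
apply/integrableP; split.
  apply/measurable_EFinP; apply: measurable_funM; first exact: measurable_funX.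
  exact: measurable_normal_pdf.
rewrite (_ : integral _ _ _ = \int[mu]_x ((x - 0) ^+ 2 * p x)%:E)%E.
  by rewrite integral_normal_sqr// ltry.
apply: eq_integral => x _.
by rewrite subr0 gee0_abs// lee_fin mulr_ge0 ?sqr_ge0 ?normal_pdf_ge0.
Qed.

Lemma integrable_dominated_normal (h : R -> R) (k : R) :
  continuous h -> (forall x, `|h x| <= k * (1 + x ^+ 2)) ->
  mu.-integrable setT (fun x : R => (h x * p x)%:E).
Proof.
move=> ch hk.
apply: (@le_integrable _ _ _ mu setT _ _ (fun x : R => (k%:E * ((1 + x ^+ 2) * p x)%:E)%E)) => //.
- apply/measurable_EFinP; apply: continuous_measurable_fun.
  exact: continuous_mul_normal_pdf.
- move=> x _; rewrite -EFinM !abse_EFin lee_fin.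
  rewrite [leRHS]ger0_norm ?mulrA; last first.
    by rewrite mulr_ge0 ?normal_pdf_ge0// (le_trans _ (hk x)).
  by rewrite normrM (ger0_norm (normal_pdf_ge0 _ _ _)) ler_wpM2r ?normal_pdf_ge0.
- by apply: integrableZl => //; exact: integrable_normal_1Dsqr.
Qed.

End normal_cos.

(** * Characteristic function of the centred normal law, with a phase *)

Section normal_characteristic_function.
Context (R : realType).
Local Notation mu := (@lebesgue_measure R).
Variables (s theta : R).
Hypothesis s0 : s != 0.
Local Notation p := (normal_pdf 0 s).

Lemma integrable_normal_cos t :
  mu.-integrable setT (fun x : R => (cos (t * x + theta) * p x)%:E).
Proof.
apply: (@integrable_dominated_normal _ _ s0 _ 1).
  by apply: derivable_continuous => x.
by move=> x; rewrite mul1r (le_trans (norm_cos_le1 _))// lerDl sqr_ge0.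
Qed.

Lemma integrable_normal_xsin t :
  mu.-integrable setT (fun x : R => (x * sin (t * x + theta) * p x)%:E).
Proof.
apply: (@integrable_dominated_normal _ _ s0 _ 1).
  by apply: derivable_continuous => x.
move=> x; rewrite mul1r normrM (le_trans _ (norm_le_1Dsqr x))//.
by rewrite ler_piMr// norm_sin_le1.
Qed.

(** Gaussian integration by parts: the derivative of - s^2 sin (t x + theta) p is (x sin (t x +
    theta) - s^2 t cos (t x + theta)) p, and it integrates to 0. *)
Lemma Rintegral_normal_xsin t :
  \int[mu]_x (x * sin (t * x + theta) * p x) =
  s ^+ 2 * t * \int[mu]_x (cos (t * x + theta) * p x).
Proof.
have dp := is_derive_normal_pdf 0 s0.
pose h (x : R) := x * sin (t * x + theta) - s ^+ 2 * t * cos (t * x + theta).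
pose k := 1 + s ^+ 2 * `|t|.
(* [h] changes sign, whereas [ge0_integralT_ftc] wants nonnegative functions: the integrable
   majorant [g] is added to [h * p] and subtracted again after integration. *)
pose g (x : R) := k * (1 + x ^+ 2) * p x.
pose F (x : R) := - s ^+ 2 * sin (t * x + theta) * p x.
have k1 : 1 <= k by rewrite lerDl mulr_ge0 ?sqr_ge0.
have ch : continuous h by apply: derivable_continuous => x.
have cg : continuous g by apply: continuous_mul_normal_pdf => //; apply: derivable_continuous => x.
have hk x : `|h x| <= k * (1 + x ^+ 2).
  rewrite (le_trans (ler_normB _ _))// 3!normrM (ger0_norm (sqr_ge0 s)).
  have a1 := ler_wpM2l (normr_ge0 x) (norm_sin_le1 (t * x + theta)).
  have a2 := ler_wpM2l (mulr_ge0 (sqr_ge0 s) (normr_ge0 t)) (norm_cos_le1 (t * x + theta)).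
  have := mulr_ge0 (mulr_ge0 (sqr_ge0 s) (normr_ge0 t)) (sqr_ge0 x).
  by have := norm_le_1Dsqr x; rewrite /k; lra.
have g0 x : 0 <= g x.
  by rewrite mulr_ge0 ?normal_pdf_ge0// (le_trans _ (hk x)).
have dF (x : R) : is_derive x (1 : R) F ((g x + h x * p x) - g x).
  rewrite /F; apply: is_derive_eq.
  by rewrite /GRing.scale/= /g /h; field; rewrite s0.
have ihp : mu.-integrable setT (fun x : R => (h x * p x)%:E).
  exact: (@integrable_dominated_normal _ _ s0 _ k).
have ig : mu.-integrable setT (fun x : R => (g x)%:E).
  apply: (@integrable_dominated_normal _ _ s0 _ k).
    by apply: derivable_continuous => x.
  by move=> x; rewrite ger0_norm// (le_trans _ (hk x)).
have h0 : (\int[mu]_x (h x * p x)%:E = 0)%E.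
  have E : (\int[mu]_x (g x + h x * p x)%:E = \int[mu]_x (g x)%:E + 0%:E)%E.
    apply: (ge0_integralT_ftc dF) => //.
    - by move=> x; apply: cvgD; [exact: cg|exact: continuous_mul_normal_pdf].
    - move=> x; rewrite /g -mulrDl mulr_ge0 ?normal_pdf_ge0//.
      by have := hk x; rewrite ler_norml => /andP[]; lra.
    - apply: (@cvg_symmetric_diff0 _ _ 0 (s ^+ 2 * ((1 + 2 * s ^+ 2) * normal_peak s))) => x.
      have /= := normal_pdf_affine_decay 0 s0 1 0 x.
      rewrite mul0r addr0 mul1r normr1 normr0 addr0 mul1r => D.
      rewrite /F mulrAC normrM -mulrA normrM -mulrA -[leRHS]mulr1 normrN.
      have := ler_wpM2l (normr_ge0 (p x * (x - 0))) (norm_sin_le1 (t * x + theta)).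
      have := ler_wpM2l (sqr_ge0 s) D.
      have := sqr_ge0 s.
      rewrite (ger0_norm (sqr_ge0 s)) normrM; nra.
  move: E; under eq_integral do rewrite EFinD.
  rewrite integralD// adde0 => /(congr1 (fun z => z - \int[mu]_x (g x)%:E)%E).
  have fg := integrable_fin_num measurableT ig.
  by rewrite addeAC subee// add0e.
rewrite -RintegralZl//; last exact: integrable_normal_cos.
apply/eqP; rewrite -subr_eq0 -RintegralB//; last 2 first.
- exact: integrable_normal_xsin.
- have : mu.-integrable setT (fun x : R => (s ^+ 2 * t)%:E * (cos (t * x + theta) * p x)%:E)%E.
    by apply: integrableZl => //; exact: integrable_normal_cos.
  exact.
rewrite /Rintegral; under eq_integral.
  move=> x _.
  rewrite (_ : _ - _ = h x * p x); last by rewrite /h; ring.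
  over.
by rewrite h0.
Qed.

End normal_characteristic_function.

Section normal_cos_transform.
Context (R : realType).
Local Notation mu := (@lebesgue_measure R).
Variables (s theta : R).
Hypothesis s0 : s != 0.
Local Notation p := (normal_pdf 0 s).

Let phi (t : R) : R := \int[mu]_x (cos (t * x + theta) * p x).

Let f (t x : R) : R := cos (t * x + theta) * p x.

Let df t x : partial1of2 f t x = - (x * sin (t * x + theta) * p x).
Proof.
rewrite partial1of2E /f.
have D : is_derive t (1 : R) (fun t => cos (t * x + theta) * p x)
    (- (x * sin (t * x + theta) * p x)).
  by apply: is_derive_eq; rewrite /GRing.scale/=; ring.
by have [] := D.
Qed.

(** Differentiation under the integral sign, dominated by (1 + x^2) p, followed by
    [Rintegral_normal_xsin]: [phi] solves a linear differential equation. *)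
Let is_derive_phi (t : R) : is_derive t (1 : R) phi (- (s ^+ 2 * t * phi t)).
Proof.
have It : `]t - 1, t + 1[%classic t by rewrite /= in_itv/= ltrBlDr ltrDl ltr01.
have intf x : `]t - 1, t + 1[%classic x -> mu.-integrable setT (EFin \o f x).
  by move=> _; exact: integrable_normal_cos.
have derf x y : `]t - 1, t + 1[%classic x -> setT y -> derivable (f ^~ y) x 1.
  by move=> _ _; rewrite /f.
pose G (x : R) : R := (1 + x ^+ 2) * p x.
have G0 x : 0 <= G x by rewrite mulr_ge0 ?normal_pdf_ge0// addr_ge0// sqr_ge0.
have iG : mu.-integrable setT (EFin \o G) by exact: integrable_normal_1Dsqr.
have Gub x y : `]t - 1, t + 1[%classic x -> setT y -> `|partial1of2 f x y| <= G y.
  move=> _ _; rewrite df normrN normrM (ger0_norm (normal_pdf_ge0 _ _ _)).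
  rewrite ler_wpM2r ?normal_pdf_ge0// normrM (le_trans _ (norm_le_1Dsqr y))//.
  by rewrite ler_piMr// norm_sin_le1.
apply: DeriveDef.
  exact: (derivable_under_integral measurableT It intf derf G0 iG Gub).
rewrite -derive1E (differentiation_under_integral measurableT It intf derf G0 iG Gub).
rewrite /phi -(Rintegral_normal_xsin _ s0) -mulN1r -RintegralZl//.
  by apply: eq_Rintegral => x _; rewrite df mulN1r.
exact: integrable_normal_xsin.
Qed.

Lemma Rintegral_normal_cos t :
  \int[mu]_x (cos (t * x + theta) * p x) =
  cos theta * expR (- (s ^+ 2 * t ^+ 2 / 2)).
Proof.
(* The exponential is the integrating factor of phi' = - s^2 t phi, so [psi] is constant, equal to
   its value cos theta at 0. *)
pose psi (t : R) := phi t * expR (s ^+ 2 * t ^+ 2 / 2).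
have dpsi (x : R) : is_derive x (1 : R) psi 0.
  have dphi : is_derive x (1 : R) phi (- (s ^+ 2 * x * phi x)) by exact: is_derive_phi.
  by rewrite /psi; apply: is_derive_eq; rewrite /GRing.scale/=; field.
have := @is_derive_0_is_cst _ psi t 0 dpsi.
rewrite /psi expr0n/= mulr0 mul0r expR0 mulr1 => E.
apply: (@mulIf _ (expR (s ^+ 2 * t ^+ 2 / 2))); first by rewrite gt_eqF ?expR_gt0.
rewrite -/(phi t) E -[RHS]mulrA -expRD addNr expR0 mulr1 /phi.
under eq_Rintegral do rewrite mul0r add0r.
rewrite RintegralZl//; last exact: integrable_normal_pdf.
by rewrite /Rintegral integral_normal_pdf mulr1.
Qed.

Lemma integral_normal_1Dcos t :
  (\int[mu]_x ((1 + cos (t * x + theta)) * p x)%:E =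
   (1 + cos theta * expR (- (s ^+ 2 * t ^+ 2 / 2)))%:E)%E.
Proof.
under eq_integral do rewrite mulrDl mul1r EFinD.
rewrite integralD//; [|exact: integrable_normal_pdf|exact: integrable_normal_cos].
rewrite integral_normal_pdf EFinD -Rintegral_normal_cos fineK//.
exact: (integrable_fin_num measurableT (integrable_normal_cos _ s0 _)).
Qed.

End normal_cos_transform.

(** * Integrals against normal and degenerate Gaussian laws *)

Lemma ge0_integral_normal_prob (R : realType) (m s : R) (f : R -> R) :
  measurable_fun setT f -> (forall x, 0 <= f x) ->
  (\int[normal_prob m s]_x (f x)%:E =
   \int[lebesgue_measure]_x (f x * normal_pdf m s x)%:E)%E.
Proof.
move=> mf f0.
have D (B : set R) : measurable B ->
    (\int[lebesgue_measure]_(x in id @^-1` B) (normal_pdf m s x)%:E =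
     1%:E * normal_prob m s B)%E by move=> _; rewrite mul1e.
have := @ge0_integral_transfer _ _ _ _ R lebesgue_measure (normal_prob m s)
  (normal_pdf m s) id 1 (measurable_normal_pdf m s) (normal_pdf_ge0 m s)
  (@measurable_id _ _ _) D f mf f0.
rewrite mul1e => <-.
by apply: eq_integral => x _; rewrite mulrC.
Qed.

(** Completing the exponent: 1 / (2 s^2) + c = r^2 / (2 s^2) for r^2 = 1 + 2 c s^2, so the integrand
    times the density is 1 / r times the normal density of deviation s / r. *)
Lemma integral_normal_gauss (R : realType) (s c : R) : s != 0 -> 0 <= c ->
  (\int[normal_prob 0 s]_x (expR (- (c * x ^+ 2)))%:E =
   ((Num.sqrt (1 + 2 * c * s ^+ 2))^-1)%:E)%E.
Proof.
move=> s0 c0.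
have s2 : 0 < s ^+ 2 by rewrite exprn_even_gt0.
pose r := Num.sqrt (1 + 2 * c * s ^+ 2).
have r20 : 0 < 1 + 2 * c * s ^+ 2 by have := mulr_ge0 c0 (ltW s2); nra.
have r0 : 0 < r by rewrite sqrtr_gt0.
have rE : r ^+ 2 = 1 + 2 * c * s ^+ 2 by rewrite sqr_sqrtr// ltW.
have sr0 : s / r != 0 by rewrite mulf_neq0// invr_neq0// gt_eqF.
rewrite ge0_integral_normal_prob; last 2 first.
- by apply: continuous_measurable_fun; apply: derivable_continuous => x.
- by move=> x; exact: expR_ge0.
have peak : normal_peak s = r^-1 * normal_peak (s / r).
  have pk t : normal_peak t = (`|t| * Num.sqrt (pi *+ 2))^-1 :> R.
    by rewrite /normal_peak -mulrnAr sqrtrM ?sqr_ge0// sqrtr_sqr.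
  have q0 : Num.sqrt (pi *+ 2 : R) != 0 by rewrite gt_eqF// sqrtr_gt0 pmulrn_lgt0 ?pi_gt0.
  rewrite !pk normf_div (gtr0_norm r0); field.
  by rewrite q0 normr_eq0 s0 gt_eqF.
transitivity (\int[lebesgue_measure]_x (r^-1%:E * (normal_pdf 0 (s / r) x)%:E))%E.
  apply: eq_integral => x _; rewrite -EFinM !normal_pdfE// peak; congr (_%:E).
  rewrite mulrCA -mulrA; congr (_ * (_ * _)); rewrite /normal_fun -expRD subr0.
  congr expR; rewrite exprMn exprVn rE; field.
  by rewrite s0 gt_eqF.
rewrite integralZl//; last exact: integrable_normal_pdf.
by rewrite integral_normal_pdf mule1.
Qed.

Lemma ge0_integral_law d d' (T : measurableType d) (T' : measurableType d')
    (R : realType) (mu : {measure set T -> \bar R})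
    (nu : {measure set T' -> \bar R}) (Z : T -> T') (f : T' -> R) :
  measurable_fun setT Z ->
  (forall A, measurable A -> mu (Z @^-1` A) = nu A) ->
  measurable_fun setT f -> (forall x, 0 <= f x) ->
  (\int[mu]_w (f (Z w))%:E = \int[nu]_x (f x)%:E)%E.
Proof.
move=> mZ Znu mf f0.
have D (B : set T') : measurable B ->
    (\int[mu]_(x in Z @^-1` B) 1%:E = 1%:E * nu B)%E.
  move=> mB; rewrite integral_cst; last by rewrite -[_ @^-1` _]setTI; exact: mZ.
  by rewrite !mul1e; exact: Znu.
have m1 : measurable_fun setT (fun _ : T => (1 : R)) by exact: measurable_cst.
have := @ge0_integral_transfer _ _ _ _ R mu nu (fun=> 1) Z 1 m1 (fun=> ler01) mZ D f mf f0.
rewrite mul1e => <-.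
by apply: eq_integral => x _; rewrite mul1r.
Qed.

Section gaussian_law_integrals.
Context d (T : measurableType d) (R : realType) (P : probability T R).
Variables (Z : T -> R) (m s : R).
Hypothesis mZ : measurable_fun setT Z.
Hypothesis ZE : forall A, measurable A -> P (Z @^-1` A) = gaussian_law m s A.

Lemma gaussian_law_second_moment (a : R) :
  (\int[P]_w ((Z w - a) ^+ 2)%:E = ((m - a) ^+ 2 + s ^+ 2)%:E)%E.
Proof.
have mf : measurable_fun setT (fun x : R => (x - a) ^+ 2).
  by apply: continuous_measurable_fun; apply: derivable_continuous => x.
have f0 (x : R) : 0 <= (x - a) ^+ 2 by exact: sqr_ge0.
have [s0|s0] := eqVneq s 0.
  have E (A : set R) : measurable A -> P (Z @^-1` A) = \d_m A.
    by move=> mA; rewrite ZE// /gaussian_law s0 eqxx.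
  rewrite (ge0_integral_law mZ E mf f0) integral_dirac//.
    by rewrite diracT mul1e s0 expr0n addr0.
  exact/measurable_EFinP.
have E (A : set (measurableTypeR R)) : measurable A -> P (Z @^-1` A) = normal_prob m s A.
  by move=> mA; rewrite ZE// /gaussian_law (negbTE s0).
rewrite (@ge0_integral_law _ _ T (measurableTypeR R) R P (normal_prob m s) Z _ mZ E mf f0)
  ge0_integral_normal_prob//.
exact: integral_normal_sqr.
Qed.

Lemma gaussian_law_1Dcos : m = 0 ->
  (\int[P]_w (1 + cos (Z w))%:E = (1 + expR (- (s ^+ 2 / 2)))%:E)%E.
Proof.
move=> m0.
have mf : measurable_fun setT (fun x : R => 1 + cos x).
  by apply: continuous_measurable_fun; apply: derivable_continuous => x.
have f0 (x : R) : 0 <= 1 + cos x by rewrite addrC -lerBlDr sub0r cos_geN1.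
have [s0|s0] := eqVneq s 0.
  have E (A : set R) : measurable A -> P (Z @^-1` A) = \d_m A.
    by move=> mA; rewrite ZE// /gaussian_law s0 eqxx.
  rewrite (ge0_integral_law mZ E mf f0) integral_dirac//.
    by rewrite diracT mul1e s0 m0 cos0 expr0n mul0r oppr0 expR0.
  exact/measurable_EFinP.
have E (A : set (measurableTypeR R)) : measurable A -> P (Z @^-1` A) = normal_prob 0 s A.
  by move=> mA; rewrite ZE// /gaussian_law (negbTE s0) m0.
rewrite (@ge0_integral_law _ _ T (measurableTypeR R) R P (normal_prob 0 s) Z _ mZ E mf f0)
  ge0_integral_normal_prob//.
have := integral_normal_1Dcos 0 s0 1; rewrite cos0 mul1r expr1n mulr1 => <-.
by apply: eq_integral => x _; rewrite mul1r addr0.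
Qed.

End gaussian_law_integrals.

(** * Moments and characteristic function of one channel *)

Section integrates_to.
Context d (T : measurableType d) (R : realType) (P : probability T R).

(** Integrability and value are bundled so that a polynomial in I and Q is integrated by nesting the
    three closure rules below. *)
Definition integrates_to (f : T -> R) (v : R) :=
  P.-integrable setT (fun w => (f w)%:E) /\ (\int[P]_w (f w)%:E = v%:E)%E.

Lemma integrates_to_cst (k : R) : integrates_to (fun=> k) k.
Proof.
split; first by apply: (@bounded_integrable _ _ _ _ _ `|k|) => //; exact: measurable_cst.
rewrite integral_cst// -[RHS]mule1; congr (_ * _)%E; exact: probability_setT.
Qed.

Lemma integrates_toZ k f v : integrates_to f v ->
  integrates_to (fun w => k * f w) (k * v).
Proof.
move=> [If Ef]; split.
  have : P.-integrable setT (fun w => k%:E * (f w)%:E)%E by exact: integrableZl.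
  exact.
by under eq_integral do rewrite EFinM; rewrite integralZl// Ef.
Qed.

Lemma integrates_toD f g u v : integrates_to f u -> integrates_to g v ->
  integrates_to (fun w => f w + g w) (u + v).
Proof.
move=> [If Ef] [Ig Eg]; split.
  have : P.-integrable setT (fun w => (f w)%:E + (g w)%:E)%E by exact: integrableD.
  exact.
by under eq_integral do rewrite EFinD; rewrite integralD// Ef Eg.
Qed.

End integrates_to.

Section gaussian_pair.
Context d (T : measurableType d) (R : realType) (P : probability T R).
Variables (I Q : T -> R) (v : R).
Hypothesis mI : measurable_fun setT I.
Hypothesis mQ : measurable_fun setT Q.
Hypothesis gaussIQ : forall a b : R, exists m s : R, 0 <= s /\
  forall A : set R, measurable A ->
    P ((fun w => a * I w + b * Q w) @^-1` A) = gaussian_law m s A.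
Hypothesis EI : ('E_P[I] = 0)%E.
Hypothesis EQ : ('E_P[Q] = 0)%E.
Hypothesis VI : covariance P I I = v%:E.
Hypothesis VQ : covariance P Q Q = v%:E.
Hypothesis CIQ : covariance P I Q = 0%E.

Let covE X Y : ('E_P[X] = 0)%E -> ('E_P[Y] = 0)%E ->
  (covariance P X Y = \int[P]_w (X w * Y w)%:E)%E.
Proof.
move=> X0 Y0; rewrite covariance.unlock X0 Y0 /= expectation.unlock.
by apply: eq_integral => w _; rewrite -[in RHS](subr0 (X w)) -[in RHS](subr0 (Y w)).
Qed.

(** A covariance equal to the real number [v] makes the integral of the nonnegative function X^2
    finite, which is where square integrability comes from; integrability of X and of I Q then
    follows by domination. *)
Let sqr_integrates X : measurable_fun setT X -> ('E_P[X] = 0)%E ->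
  covariance P X X = v%:E -> integrates_to P (fun w => X w ^+ 2) v.
Proof.
move=> mX X0; rewrite covE// => V; split => //.
apply/integrableP; split; first by apply/measurable_EFinP; exact: measurable_funX.
rewrite (_ : integral _ _ _ = v%:E) ?ltry// -V.
by apply: eq_integral => w _; rewrite gee0_abs// lee_fin sqr_ge0.
Qed.

Let IntI2 := sqr_integrates mI EI VI.
Let IntQ2 := sqr_integrates mQ EQ VQ.

Let IntX X : measurable_fun setT X -> ('E_P[X] = 0)%E ->
  integrates_to P (fun w => X w ^+ 2) v -> integrates_to P X 0.
Proof.
move=> mX X0 H; split; last by apply: etrans X0; rewrite expectation.unlock.
have [I1 _] := integrates_toD (integrates_to_cst P 1) H.
apply: (le_integrable measurableT _ _ I1); first exact/measurable_EFinP.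
move=> w _; rewrite lee_fin (le_trans (norm_le_1Dsqr _))//.
by rewrite ler_norm.
Qed.

Let IntIQ : integrates_to P (fun w => I w * Q w) 0.
Proof.
split; last by apply: etrans CIQ; rewrite covE.
have [I1 _] := integrates_toD IntI2 IntQ2.
apply: (le_integrable measurableT _ _ I1).
  by apply/measurable_EFinP; exact: measurable_funM.
move=> w _; rewrite lee_fin [leRHS]ger0_norm ?addr_ge0 ?sqr_ge0//.
rewrite ler_norml; have := sqr_ge0 (I w + Q w); have := sqr_ge0 (I w - Q w).
have := sqr_ge0 (I w); have := sqr_ge0 (Q w).
by move=> *; apply/andP; split; nra.
Qed.

Lemma gaussian_pair_sqr (a b c : R) :
  (\int[P]_w ((a * I w + b * Q w - c) ^+ 2)%:E =
   ((a ^+ 2 + b ^+ 2) * v + c ^+ 2)%:E)%E.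
Proof.
have HI := IntX mI EI IntI2; have HQ := IntX mQ EQ IntQ2.
have [_] := integrates_toD (integrates_toZ (a ^+ 2) IntI2)
  (integrates_toD (integrates_toZ (b ^+ 2) IntQ2)
  (integrates_toD (integrates_toZ (2 * a * b) IntIQ)
  (integrates_toD (integrates_toZ (- (2 * c * a)) HI)
  (integrates_toD (integrates_toZ (- (2 * c * b)) HQ)
    (integrates_to_cst P (c ^+ 2)))))).
rewrite [X in _ = X%:E -> _](_ : _ = (a ^+ 2 + b ^+ 2) * v + c ^+ 2); last by ring.
by move=> <-; apply: eq_integral => w _; congr (_%:E); ring.
Qed.

(* The second moments of aI+bQ about 0 and about 1 determine the parameters m
   and s of its law. *)
Lemma gaussian_pair_1Dcos (a b : R) :
  (\int[P]_w (1 + cos (a * I w + b * Q w))%:E =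
   (1 + expR (- ((a ^+ 2 + b ^+ 2) * v / 2)))%:E)%E.
Proof.
have [m [s [s0 Z]]] := gaussIQ a b.
have mZ : measurable_fun setT (fun w => a * I w + b * Q w).
  by apply: measurable_funD; exact: measurable_funM.
have := gaussian_law_second_moment mZ Z 0; rewrite gaussian_pair_sqr => -[h0].
have := gaussian_law_second_moment mZ Z 1; rewrite gaussian_pair_sqr => -[h1].
have m0 : m = 0 by lra.
have sE : s ^+ 2 = (a ^+ 2 + b ^+ 2) * v by rewrite m0 in h0; lra.
by rewrite (gaussian_law_1Dcos mZ Z m0) sE.
Qed.

End gaussian_pair.

Lemma ge0_integral_affine d (T : measurableType d) (R : realType)
    (P : probability T R) (f : T -> R) (a b : R) :
  measurable_fun setT f -> (forall x, 0 <= f x) -> 0 <= a -> 0 <= b ->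
  (\int[P]_x (a + b * f x)%:E = a%:E + b%:E * \int[P]_x (f x)%:E)%E.
Proof.
move=> mf f0 a0 b0.
under eq_integral do rewrite EFinD EFinM.
rewrite ge0_integralD//; last 2 first.
- by move=> x _; rewrite -EFinM lee_fin mulr_ge0.
- by apply: emeasurable_funM; exact/measurable_EFinP.
rewrite ge0_integralZl//; last 2 first.
- exact/measurable_EFinP.
- by move=> x _; rewrite lee_fin.
rewrite integral_cst//; congr (_ + _)%E; rewrite -[RHS]mule1; congr (_ * _)%E.
exact: probability_setT.
Qed.

(** * Laplace transform of I^2 + Q^2 *)

Section gaussian_pair_laplace.
Context d (T : measurableType d) (R : realType) (P : probability T R).
Variables (I Q : T -> R) (v l : R).
Hypothesis mI : measurable_fun setT I.
Hypothesis mQ : measurable_fun setT Q.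
Hypothesis v0 : 0 <= v.
Hypothesis l0 : 0 < l.
Hypothesis IQcos : forall a b : R,
  (\int[P]_w (1 + cos (a * I w + b * Q w))%:E =
   (1 + expR (- ((a ^+ 2 + b ^+ 2) * v / 2)))%:E)%E.

Local Notation N := (normal_prob (0 : R) (Num.sqrt (2 * l))).
(** The mean of exp (- v g^2 / 2) for g of law [N]; each of the two auxiliary Gaussians contributes
    one such factor. *)
Let k : R := (Num.sqrt (1 + 2 * l * v))^-1.

Let s0 : Num.sqrt (2 * l) != 0.
Proof. by rewrite gt_eqF// sqrtr_gt0 mulr_gt0. Qed.

Let s2 : Num.sqrt (2 * l) ^+ 2 = 2 * l.
Proof. by rewrite sqr_sqrtr// mulr_ge0// ltW. Qed.

Let onecos_ge0 (x : R) : 0 <= 1 + cos x.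
Proof. by rewrite addrC -lerBlDr sub0r cos_geN1. Qed.

Let measurable_cosR : measurable_fun setT (cos : R -> R).
Proof. by apply: continuous_measurable_fun; exact: continuous_cos. Qed.

Let N_1Dcos (a theta : R) :
  (\int[N]_g (1 + cos (a * g + theta))%:E =
   (1 + cos theta * expR (- (l * a ^+ 2)))%:E)%E.
Proof.
rewrite ge0_integral_normal_prob//; last first.
  by apply: continuous_measurable_fun; apply: derivable_continuous => x.
rewrite (integral_normal_1Dcos _ s0) s2; congr ((1 + _ * expR _)%:E); by field.
Qed.

Let N_1Dcos_scaled (a e : R) : 0 <= e -> e <= 1 ->
  (\int[N]_g (1 + cos (a * g) * e)%:E = (1 + e * expR (- (l * a ^+ 2)))%:E)%E.
Proof.
move=> e0 e1.
(* A convex combination of 1 and 1 + cos, hence nonnegative termwise because 0 <= e <= 1. *)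
transitivity (\int[N]_g ((1 - e) + e * (1 + cos (a * g + 0)))%:E)%E.
  by apply: eq_integral => g _; rewrite addr0; congr (_%:E); ring.
rewrite ge0_integral_affine ?subr_ge0//; last first.
  by apply: continuous_measurable_fun; apply: derivable_continuous => x.
by rewrite N_1Dcos cos0 -EFinM -EFinD; congr (_%:E); ring.
Qed.

Let N_1Dgauss (e : R) : 0 <= e ->
  (\int[N]_g (1 + e * expR (- (v / 2 * g ^+ 2)))%:E = (1 + e * k)%:E)%E.
Proof.
move=> e0; rewrite ge0_integral_affine//; last first.
  by apply: continuous_measurable_fun; apply: derivable_continuous => x.
rewrite integral_normal_gauss// ?divr_ge0// s2 -EFinM -EFinD /k.
by congr ((1 + e * (Num.sqrt (1 + _))^-1)%:E); field.
Qed.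

Let fubini_gauss (h : T -> R -> R) :
  measurable_fun setT (fun z : T * (measurableTypeR R) => h z.1 z.2) -> (forall w g, 0 <= h w g) ->
  (\int[P]_w \int[N]_g (h w g)%:E = \int[N]_g \int[P]_w (h w g)%:E)%E.
Proof.
move=> mh h0.
apply: (@fubini_tonelli _ _ T (measurableTypeR R) R P N (fun z => (h z.1 z.2)%:E)).
  exact/measurable_EFinP.
by move=> z; rewrite lee_fin.
Qed.

(** A Gaussian frequency [g] on Q, with a I as phase, produces exp (- l Q^2). After the exchange the
    inner expectation is that of 1 + cos (a I + g Q), known from [IQcos], and its dependence on [g]
    integrates to [k]. *)
Let step1 (a : R) :
  (\int[P]_w (1 + cos (a * I w) * expR (- (l * Q w ^+ 2)))%:E =
   (1 + expR (- (a ^+ 2 * v / 2)) * k)%:E)%E.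
Proof.
transitivity (\int[P]_w \int[N]_g (1 + cos (Q w * g + a * I w))%:E)%E.
  by apply: eq_integral => w _; rewrite N_1Dcos.
rewrite fubini_gauss//; last first.
  apply: measurable_funD => //; apply: measurableT_comp => //; apply: measurable_funD.
    by apply: measurable_funM => //; apply: measurableT_comp.
  by apply: measurable_funM => //; apply: measurableT_comp.
rewrite -N_1Dgauss ?expR_ge0//; apply: eq_integral => g _.
rewrite (eq_integral (fun w => (1 + cos (a * I w + g * Q w))%:E)); last first.
  by move=> w _; congr ((1 + cos _)%:E); ring.

rewrite IQcos -expRD; congr ((1 + expR _)%:E); by field.
Qed.

Lemma gaussian_pair_laplace :
  (\int[P]_w (expR (- (l * (I w ^+ 2 + Q w ^+ 2))))%:E =
   ((1 + 2 * l * v)^-1)%:E)%E.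
Proof.
have mexp : measurable_fun setT (fun w => expR (- (l * (I w ^+ 2 + Q w ^+ 2)))).
  by apply: measurable_expR_comp; apply: measurable_funD; exact: measurable_funX.
have r0 : 0 < 1 + 2 * l * v by rewrite ltr_pwDl// !mulr_ge0// ltW.
have k2 : k * k = (1 + 2 * l * v)^-1.
  by rewrite /k -invfM -expr2 sqr_sqrtr// ltW.
have E : (\int[P]_w (1 + 1 * expR (- (l * (I w ^+ 2 + Q w ^+ 2))))%:E =
    (1 + k * k)%:E)%E.
  (* The second frequency linearises I^2 while exp (- l Q^2) stays as a weight in [0, 1]; after the
     exchange [step1] applies with [a] equal to that frequency. *)
  transitivity (\int[P]_w \int[N]_g (1 + cos (I w * g) * expR (- (l * Q w ^+ 2)))%:E)%E.
    apply: eq_integral => w _; rewrite N_1Dcos_scaled ?expR_ge0//.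
      by rewrite -expRD mul1r; congr ((1 + expR _)%:E); ring.
    by rewrite expR_le1 oppr_le0 mulr_ge0 ?sqr_ge0// ltW.
  rewrite fubini_gauss; last 2 first.
  - apply: measurable_funD => //; apply: measurable_funM.
      apply: measurableT_comp => //; apply: measurable_funM => //.
      exact: measurableT_comp.
    apply: measurable_expR_comp; apply: measurable_funX; exact: measurableT_comp.
  - move=> w g.
    have e1 : expR (- (l * Q w ^+ 2)) <= 1.
      by rewrite expR_le1 oppr_le0 mulr_ge0 ?sqr_ge0// ltW.
    have e0 := expR_ge0 (- (l * Q w ^+ 2)).
    have := cos_geN1 (I w * g); nra.
  rewrite -N_1Dgauss ?invr_ge0//; apply: eq_integral => g _.
  under eq_integral do rewrite [I _ * _]mulrC.
  rewrite step1 mulrC; congr ((1 + _ * expR _)%:E); by field.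
move: E; rewrite ge0_integral_affine//.
rewrite mul1e EFinD k2 => /(congr1 (fun z => z - 1%:E)%E) /=.
by rewrite ![(1%:E + _)%E]addeC !addeK.
Qed.

End gaussian_pair_laplace.

(** * Laplace transform of the squared estimator *)

Section sigma_hat_laplace.
Context d (T : measurableType d) (R : realType) (P : probability T R).
Variables (N : nat) (x : 'I_N -> {RV P >-> 4.-tuple R}) (S : 'M[R]_4) (i q : 'I_4).
Variable v : R.
Hypothesis N0 : (0 < N)%N.
Hypothesis v0 : 0 <= v.
Hypothesis iq : i != q.
Hypothesis indep : mutually_independent x.
Hypothesis gauss : forall n, gaussian_vector (x n).
Hypothesis mean0 : forall n, zero_mean (x n).
Hypothesis cov : forall n, has_covariance_mx (x n) S.
Hypothesis Sii : S i i = v.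
Hypothesis Sqq : S q q = v.
Hypothesis Siq : S i q = 0.

Let mtnth j : measurable_fun setT (fun y : 4.-tuple R => tnth y j).
Proof. exact: measurable_tnth. Qed.

Let mx n j : measurable_fun setT (fun w => tnth (x n w) j).
Proof. exact: (measurableT_comp (mtnth j) (measurable_funP (x n))). Qed.

Let gauss2 n (a b : R) : exists m s : R, 0 <= s /\
  forall A : set R, measurable A ->
    P ((fun w => a * tnth (x n w) i + b * tnth (x n w) q) @^-1` A) =
    gaussian_law m s A.
Proof.
have [m [s [s0 H]]] := gauss n (fun j => if j == i then a else if j == q then b else 0).
exists m, s; split => // A mA; rewrite -H//; congr (P (_ @^-1` A)).
apply/funext => w; have qi : q != i by rewrite eq_sym.
rewrite (bigD1 i)//= eqxx (bigD1 q)//= (negbTE qi) eqxx.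
rewrite big1 ?addr0// => j /andP[ji jq].
by rewrite (negbTE ji) (negbTE jq) mul0r.
Qed.

Lemma laplace_sample n (l : R) : 0 < l ->
  (\int[P]_w (expR (- (l * (tnth (x n w) i ^+ 2 + tnth (x n w) q ^+ 2))))%:E =
   ((1 + 2 * l * v)^-1)%:E)%E.
Proof.
move=> l0.
apply: (@gaussian_pair_laplace _ _ _ P _ _ v l (mx n i) (mx n q) v0 l0) => a b.
apply: (@gaussian_pair_1Dcos _ _ _ P _ _ v (mx n i) (mx n q) (gauss2 n)
  (mean0 n i) (mean0 n q)).
- by rewrite (cov n i i) Sii.
- by rewrite (cov n q q) Sqq.
- by rewrite (cov n i q) Siq.
Qed.

Lemma sigma_hat_ge0 w : 0 <= sigma_hat x i q w.
Proof. exact: sqrtr_ge0. Qed.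

Lemma measurable_sigma_hat : measurable_fun setT (sigma_hat x i q).
Proof.
apply: measurableT_comp; first by apply: continuous_measurable_fun; exact: sqrt_continuous.
apply: measurable_funM => //; apply: measurable_sum => n.
by apply: measurable_funD; exact: measurable_funX.
Qed.

Lemma laplace_sigma_hat_sqr (l : R) : 0 < l ->
  (\int[P]_w (expR (- (l * sigma_hat x i q w ^+ 2)))%:E =
   (((1 + l * v / N%:R)^-1) ^+ N)%:E)%E.
Proof.
move=> l0.
have N1 : 0 < N%:R :> R by rewrite ltr0n.
(* [l] times the squared estimator is [c] times the sum over the samples, and 2 c v = l v / N. *)
pose c := l * (2 * N%:R)^-1.
have c0 : 0 < c by rewrite mulr_gt0// invr_gt0 mulr_gt0.
pose f (n : 'I_N) (y : 4.-tuple R) := expR (- (c * (tnth y i ^+ 2 + tnth y q ^+ 2))).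
have mf n : measurable_fun setT (f n).
  by apply: measurable_expR_comp; apply: measurable_funD; exact: measurable_funX.
have f0 n y : 0 <= f n y by exact: expR_ge0.
have := independent_integral_prod indep mf f0 (fun n => laplace_sample n c0).
rewrite prodr_const card_ord.
rewrite (_ : 2 * c * v = l * v / N%:R); last by rewrite /c; field; rewrite gt_eqF.
move=> <-; apply: eq_integral => w _.
rewrite /sigma_hat sqr_sqrtr; last first.
  rewrite mulr_ge0 ?invr_ge0 ?mulr_ge0//; apply: sumr_ge0 => n _.
  by rewrite addr_ge0 ?sqr_ge0.
by rewrite mulrA -/c /f -expR_sum mulr_sumr sumrN.
Qed.

End sigma_hat_laplace.

(** An instance, for class inference to find when an antiderivative contains powers. For [k = 0] the
    exponent [k.-1] is 0 and the coefficient vanishes. *)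
Global Instance is_derive_pow (R : realType) (k : nat) (t : R) :
  is_derive t (1 : R) (fun u : R => u ^+ k) (k%:R * t ^+ k.-1).
Proof.
elim: k => [|k IH].
  have -> : (fun u : R => u ^+ 0) = (fun=> 1) by apply/funext => u; rewrite expr0.
  by apply: is_derive_eq; rewrite mul0r.
have -> : (fun u : R => u ^+ k.+1) = (fun u => u * u ^+ k).
  by apply/funext => u; rewrite exprS.
apply: is_derive_eq; rewrite /GRing.scale/= -natr1.
by case: k {IH} => [|k] /=; rewrite ?exprS; ring.
Qed.

(** A single term of the exponential series, y^(k+1) / (k+1)! <= exp y at y = a (n + 1), leaves a
    bound by a constant times the harmonic sequence. *)
Lemma cvg_pow_expR (R : realType) (k : nat) (a : R) : 0 < a ->
  (n.+1%:R : R) ^+ k * expR (- (a * n.+1%:R)) @[n --> \oo] --> (0 : R).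
Proof.
move=> a0; pose C := k.+1`!%:R / a ^+ k.+1.
have ub (n : nat) : (n.+1%:R : R) ^+ k * expR (- (a * n.+1%:R)) <= C * harmonic n.
  have n0 : 0 < n.+1%:R :> R by [].
  rewrite ler_pdivlMr// expRN mulrAC ler_pdivrMr ?expR_gt0// -exprSr.
  have y0 : 0 <= a * n.+1%:R by rewrite mulr_ge0// ltW.
  have := expR_ge1Dxn k y0; set E := expR _ => h.
  have fk : 0 < k.+1`!%:R :> R by rewrite ltr0n fact_gt0.
  have h2 : (a * n.+1%:R) ^+ k.+1 <= k.+1`!%:R * E.
    by rewrite -ler_pdivrMl// mulrC; apply: le_trans h; rewrite lerDr.
  by rewrite /C mulrAC ler_pdivlMr ?exprn_gt0// -exprMn [_ * a]mulrC.
apply: (@squeeze_cvgr _ _ _ _ (fun=> 0) (fun n => C * harmonic n)).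
- by near=> n; rewrite ub mulr_ge0 ?exprn_ge0 ?expR_ge0.
- exact: cvg_cst.
- by rewrite -[X in _ --> X](mulr0 C); apply: cvgMr; exact: cvg_harmonic.
Unshelve. all: by end_near. Qed.

Lemma cvg_pow_gauss (R : realType) (k : nat) (a : R) : 0 < a ->
  (n.+1%:R : R) ^+ k * expR (- (a * n.+1%:R ^+ 2)) @[n --> \oo] --> (0 : R).
Proof.
move=> a0; apply: (squeeze_cvgr _ (cvg_cst 0) (cvg_pow_expR k a0)).
near=> n; rewrite mulr_ge0 ?exprn_ge0 ?expR_ge0//= ler_wpM2l ?exprn_ge0//.
rewrite ler_expR lerN2 ler_pM2l// expr2 ler_peMr//.
by rewrite -[1]/(1%:R) ler_nat.
Unshelve. all: by end_near. Qed.

Lemma cvgN0 (R : realType) (f : nat -> R) :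
  f n @[n --> \oo] --> 0 -> - f n @[n --> \oo] --> 0.
Proof. by move=> /cvgN; rewrite oppr0. Qed.

Lemma cvgMr0 (R : realType) (f : nat -> R) (c : R) :
  f n @[n --> \oo] --> 0 -> c * f n @[n --> \oo] --> 0.
Proof. by move=> f0; rewrite -[X in _ --> X](mulr0 c); apply: cvgMr. Qed.

(** * Gamma at positive integers and odd Gaussian moments on the half-line *)

Section gamma_integrals.
Context (R : realType).
Local Notation mu := (@lebesgue_measure R).

Lemma integral_pow_expR (n : nat) :
  (\int[mu]_(t in `[0%R, +oo[) (t ^+ n * expR (- t))%:E = (n`!%:R)%:E)%E.
Proof.
elim: n => [|n IH].
  pose F (t : R) : R := - expR (- t).
  have dF (t : R) : is_derive t (1 : R) F (t ^+ 0 * expR (- t) - 0).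
    by rewrite /F; apply: is_derive_eq; rewrite /GRing.scale/=; ring.
  rewrite (ge0_integral0y_ftc dF (l := 1)).
  - by rewrite integral0 add0e.
  - have -> : (fun t : R => t ^+ 0 * expR (- t)) = (fun t => expR (- t)).
      by apply/funext => t; rewrite expr0 mul1r.
    by apply: derivable_continuous => x.
  - exact: cst_continuous.
  - by move=> x _; rewrite mulr_ge0 ?expR_ge0 ?expr0.
  - by [].
  - rewrite /F oppr0 expR0 opprK -[X in _ --> X]add0r.
    apply: cvgD; last exact: cvg_cst.
    rewrite -[X in _ --> X]oppr0; apply: cvgN.
    have := cvg_pow_expR 0 (@ltr01 R); apply: cvg_trans; apply: near_eq_cvg.
    near=> k. by rewrite expr0 !mul1r.
pose F (t : R) : R := - (t ^+ n.+1 * expR (- t)).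
have dF (t : R) : is_derive t (1 : R) F (t ^+ n.+1 * expR (- t) - n.+1%:R * (t ^+ n * expR (- t))).
  by rewrite /F; apply: is_derive_eq; rewrite /GRing.scale/=; ring.
rewrite (ge0_integral0y_ftc dF (l := 0)).
- rewrite adde0; under eq_integral do rewrite EFinM.
  rewrite ge0_integralZl//.
  + by rewrite IH factS natrM EFinM.
  + apply/measurable_EFinP; apply: measurable_funTS.
    by apply: continuous_measurable_fun; apply: derivable_continuous => x.
  + by move=> x /=; rewrite in_itv/= andbT => x0; rewrite lee_fin mulr_ge0 ?exprn_ge0 ?expR_ge0.
- by apply: derivable_continuous => x.
- by apply: derivable_continuous => x.
- by move=> x x0; rewrite mulr_ge0 ?exprn_ge0 ?expR_ge0.
- by move=> x x0; rewrite !mulr_ge0 ?exprn_ge0 ?expR_ge0.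
- rewrite (_ : (fun k => _) = (fun k => - ((k.+1%:R : R) ^+ n.+1 * expR (- (1 * k.+1%:R))))).
    exact/cvgN0/cvg_pow_expR.
  by apply/funext => k; rewrite /F expr0n/= mul0r oppr0 subr0 mul1r.
Unshelve. all: by end_near. Qed.

(** The endpoint 0 is negligible, and at positive t the real power with exponent (n + 1) - 1 is an
    ordinary one, which leaves Euler's integral for the factorial. *)
Lemma Gamma_nat (n : nat) : Gamma (n.+1%:R : R) = n`!%:R.
Proof.
rewrite /Gamma /Rintegral (_ : integral _ _ _ = (n`!%:R)%:E)//.
rewrite -integral_pow_expR -integral_itv_obnd_cbnd//; last first.
  apply/measurable_EFinP; apply: measurable_funTS.
  by apply: continuous_measurable_fun; apply: derivable_continuous => x.
apply: eq_integral => t; rewrite inE/= in_itv/= andbT => t0.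
by rewrite -natr1 addrK powR_mulrn// ltW.
Qed.

(** Integration by parts lowers the exponent by 2 at the cost of a factor n / a. With n = N - 1 the
    exponent is the 2N - 1 of the density. *)
Lemma integral_pow_gauss (n : nat) (a : R) : 0 < a ->
  (\int[mu]_(t in `[0%R, +oo[) (t ^+ (2 * n).+1 * expR (- (a * t ^+ 2)))%:E =
   (n`!%:R / (2 * a ^+ n.+1))%:E)%E.
Proof.
move=> a0; have an0 : a != 0 by rewrite gt_eqF.
elim: n => [|n IH].
  pose F (t : R) : R := - ((2 * a)^-1 * expR (- (a * t ^+ 2))).
  have dF (t : R) : is_derive t (1 : R) F (t ^+ (2 * 0).+1 * expR (- (a * t ^+ 2)) - 0).
    by rewrite /F; apply: is_derive_eq; rewrite /GRing.scale/= muln0; field.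
  rewrite (ge0_integral0y_ftc dF (l := (2 * a)^-1)).
  - by rewrite integral0 add0e fact0 mul1r.
  - by apply: derivable_continuous => x.
  - exact: cst_continuous.
  - by move=> x x0; rewrite mulr_ge0 ?expR_ge0 ?exprn_ge0.
  - by [].
  - rewrite /F expr0n/= mulr0 oppr0 expR0 opprK mulr1 -[X in _ --> X]add0r.
    apply: cvgD; last exact: cvg_cst.
    rewrite -[X in _ --> X]oppr0; apply: cvgN.
    rewrite -[X in _ --> X](mulr0 (2 * a)^-1); apply: cvgMr.
    have := cvg_pow_gauss 0 a0; apply: cvg_trans; apply: near_eq_cvg.
    near=> k. by rewrite expr0 !mul1r.
pose F (t : R) : R := - ((2 * a)^-1 * (t ^+ (2 * n).+2 * expR (- (a * t ^+ 2)))).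
pose c : R := n.+1%:R / a.
have c0 : 0 <= c by rewrite divr_ge0// ltW.
have dF (t : R) : is_derive t (1 : R) F (t ^+ (2 * n.+1).+1 * expR (- (a * t ^+ 2)) -
    c * (t ^+ (2 * n).+1 * expR (- (a * t ^+ 2)))).
  rewrite /F; apply: is_derive_eq; rewrite /GRing.scale/= /c.
  rewrite mulnS add2n !exprS (_ : (2 * n).+2%:R = 2 * n.+1%:R :> R); first by field.
  by rewrite -natrM mulnS add2n.
rewrite (ge0_integral0y_ftc dF (l := 0)).
- rewrite adde0; under eq_integral do rewrite EFinM.
  rewrite ge0_integralZl//.
  + rewrite IH -EFinM factS natrM /c [a ^+ n.+2]exprS; congr (_%:E).
    have := expf_neq0 n.+1 an0; move: (a ^+ n.+1) => p p0; field.
    by rewrite an0 p0.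
  + apply/measurable_EFinP; apply: measurable_funTS.
    by apply: continuous_measurable_fun; apply: derivable_continuous => x.
  + by move=> x /=; rewrite in_itv/= andbT => x0; rewrite lee_fin mulr_ge0 ?exprn_ge0 ?expR_ge0.
- by apply: derivable_continuous => x.
- by apply: derivable_continuous => x.
- by move=> x x0; rewrite mulr_ge0 ?exprn_ge0 ?expR_ge0.
- by move=> x x0; apply: mulr_ge0 => //; rewrite mulr_ge0 ?exprn_ge0 ?expR_ge0.
- rewrite (_ : (fun k => _) = (fun k => - ((2 * a)^-1 *
      ((k.+1%:R : R) ^+ (2 * n).+2 * expR (- (a * k.+1%:R ^+ 2)))))).
    exact/cvgN0/cvgMr0/cvg_pow_gauss.
  apply/funext => k; rewrite /F expr0n/=. by rewrite mul0r mulr0 oppr0 subr0.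
Unshelve. all: by end_near. Qed.

End gamma_integrals.

(** * The probability law with the claimed density *)

Section sigma_hat_law.
Context (R : realType).
Local Notation mu := (@lebesgue_measure R).
Variables (N : nat) (sigma : R).
Hypothesis N0 : (0 < N)%N.
Hypothesis sigma0 : 0 < sigma.

Let c : R := 2 * N%:R ^+ N / (Gamma N%:R * sigma ^+ (2 * N)).

Let GammaE : Gamma (N%:R : R) = N.-1`!%:R.
Proof. by rewrite -[in LHS](prednK N0) Gamma_nat. Qed.

Let c0 : 0 <= c.
Proof.
by rewrite /c GammaE divr_ge0 ?mulr_ge0 ?exprn_ge0 ?ler0n// ltW.
Qed.

Lemma sigma_hat_pdf_ge0 x : 0 <= sigma_hat_pdf N sigma x.
Proof.
rewrite /sigma_hat_pdf; case: ifP => // x0.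
by rewrite mulr_ge0 ?expR_ge0// mulr_ge0 ?exprn_ge0.
Qed.

(** [N.-1] puts the exponent in the form of [integral_pow_gauss], and the indicator turns the case
    distinction into a product. *)
Let pdfE x : sigma_hat_pdf N sigma x =
  c * (x ^+ (2 * N.-1).+1 * expR (- (N%:R / sigma ^+ 2 * x ^+ 2))) *
  \1_(`[0, +oo[%classic : set R) x.
Proof.
rewrite /sigma_hat_pdf indicE mem_setE in_itv/= andbT; case: ifP => _; last by rewrite mulr0.
rewrite mulr1 -/c mulrA; congr (_ * _ ^+ _ * expR _).
  by rewrite -[in LHS](prednK N0) mulnS add2n subn1.
by rewrite mulrAC.
Qed.

Lemma measurable_sigma_hat_pdf : measurable_fun setT (sigma_hat_pdf N sigma).
Proof.
apply: (eq_measurable_fun (fun x : R =>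
  c * (x ^+ (2 * N.-1).+1 * expR (- (N%:R / sigma ^+ 2 * x ^+ 2))) *
  \1_(`[0, +oo[%classic : set R) x)); first by move=> x _; exact: (esym (pdfE x)).
apply: measurable_funM; last exact: measurable_indic.
by apply: continuous_measurable_fun; apply: derivable_continuous => x.
Qed.

(** The factor exp (- l x^2) only raises the Gaussian rate from N / sigma^2 to [a], and a sigma^2 /
    N = 1 + l sigma^2 / N. The value [l = 0] gives the total mass, which makes the density a
    probability law. *)
Lemma laplace_sigma_hat_pdf (l : R) : 0 <= l ->
  (\int[mu]_x (sigma_hat_pdf N sigma x * expR (- (l * x ^+ 2)))%:E =
   (((1 + l * sigma ^+ 2 / N%:R)^-1) ^+ N)%:E)%E.
Proof.
move=> l0.
have N1 : 0 < N%:R :> R by rewrite ltr0n.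
have s2 : 0 < sigma ^+ 2 by rewrite exprn_gt0.
pose a := N%:R / sigma ^+ 2 + l.
have a0 : 0 < a by rewrite ltr_pwDl// divr_gt0.
transitivity (\int[mu]_(x in `[0%R, +oo[)
    (c%:E * (x ^+ (2 * N.-1).+1 * expR (- (a * x ^+ 2)))%:E))%E.
  rewrite [RHS]integral_mkcond; apply: eq_integral => x _.
  rewrite patchE pdfE indicE; case: ifP => _; last by rewrite mulr0 mul0r.
  have -> : expR (- (a * x ^+ 2)) =
      expR (- (N%:R / sigma ^+ 2 * x ^+ 2)) * expR (- (l * x ^+ 2)).
    by rewrite -expRD; congr expR; rewrite /a; ring.
  by rewrite mulr1 -EFinM; congr (_%:E); ring.
rewrite ge0_integralZl//; last 2 first.
- apply/measurable_EFinP; apply: measurable_funTS.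
  by apply: continuous_measurable_fun; apply: derivable_continuous => x.
- by move=> x /=; rewrite in_itv/= andbT => x0; rewrite lee_fin mulr_ge0 ?exprn_ge0 ?expR_ge0.
rewrite integral_pow_gauss// prednK// -EFinM /c GammaE; congr (_%:E).
have f0 : N.-1`!%:R != 0 :> R by rewrite pnatr_eq0 -lt0n fact_gt0.
have -> : 1 + l * sigma ^+ 2 / N%:R = a * sigma ^+ 2 / N%:R.
  by rewrite /a; field; rewrite !gt_eqF.
rewrite exprVn expr_div_n exprMn exprM.
have := expf_neq0 N (lt0r_neq0 a0); have := expf_neq0 N (lt0r_neq0 s2).
have := expf_neq0 N (lt0r_neq0 N1).
move: (a ^+ N) (sigma ^+ 2 ^+ N) (N%:R ^+ N) => p q r r0 q0 p0; field.
by rewrite p0 q0 f0 r0.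
Qed.

Lemma integral_sigma_hat_pdf :
  (\int[mu]_x (sigma_hat_pdf N sigma x)%:E = 1%:E)%E.
Proof.
transitivity (\int[mu]_x (sigma_hat_pdf N sigma x * expR (- (0 * x ^+ 2)))%:E)%E.
  by apply: eq_integral => x _; rewrite mul0r oppr0 expR0 mulr1.
by rewrite laplace_sigma_hat_pdf// !mul0r addr0 invr1 expr1n.
Qed.

Lemma integrable_sigma_hat_pdf :
  mu.-integrable setT (fun x => (sigma_hat_pdf N sigma x)%:E).
Proof.
apply/integrableP; split; first by apply/measurable_EFinP; exact: measurable_sigma_hat_pdf.
rewrite (_ : integral _ _ _ = 1%:E) ?ltry// -integral_sigma_hat_pdf.
by apply: eq_integral => x _; rewrite gee0_abs// lee_fin sigma_hat_pdf_ge0.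
Qed.

Definition sigma_hat_law : set (measurableTypeR R) -> \bar R :=
  fun A => (\int[mu]_(x in A) (sigma_hat_pdf N sigma x)%:E)%E.

Let sigma_hat_law0 : sigma_hat_law set0 = 0%E.
Proof. by rewrite /sigma_hat_law integral_set0. Qed.

Let sigma_hat_law_ge0 A : (0 <= sigma_hat_law A)%E.
Proof. by apply: integral_ge0 => x _; rewrite lee_fin sigma_hat_pdf_ge0. Qed.

Let sigma_hat_law_sigma_additive : semi_sigma_additive sigma_hat_law.
Proof.
move=> /= A mA tA mUA.
rewrite /sigma_hat_law/= integral_bigcup//=; last first.
  by apply: (integrableS _ _ (subsetT _)) => //; exact: integrable_sigma_hat_pdf.
apply: is_cvg_ereal_nneg_natsum_cond => n _ _.
by apply: integral_ge0 => /= x ?; rewrite lee_fin sigma_hat_pdf_ge0.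
Qed.

HB.instance Definition _ := isMeasure.Build _ _ _
  sigma_hat_law sigma_hat_law0 sigma_hat_law_ge0 sigma_hat_law_sigma_additive.

HB.instance Definition _ :=
  @Measure_isProbability.Build _ _ R sigma_hat_law integral_sigma_hat_pdf.

Definition sigma_hat_prob : probability (measurableTypeR R) R := sigma_hat_law.

Lemma laplace_sigma_hat_prob (l : R) : 0 <= l ->
  (\int[sigma_hat_prob]_x (expR (- (l * x ^+ 2)))%:E =
   (((1 + l * sigma ^+ 2 / N%:R)^-1) ^+ N)%:E)%E.
Proof.
move=> l0; rewrite -laplace_sigma_hat_pdf//.
have D (B : set R) : measurable B ->
    (\int[mu]_(x in id @^-1` B) (sigma_hat_pdf N sigma x)%:E =
     1%:E * sigma_hat_prob B)%E by move=> _; rewrite mul1e.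
have mf : measurable_fun setT (fun x : R => expR (- (l * x ^+ 2))).
  by apply: continuous_measurable_fun; apply: derivable_continuous => x.
have := @ge0_integral_transfer _ _ _ _ R mu sigma_hat_prob
  (sigma_hat_pdf N sigma) id 1 measurable_sigma_hat_pdf sigma_hat_pdf_ge0
  (@measurable_id _ _ _) D _ mf (fun=> expR_ge0 _).
by rewrite mul1e => <-.
Qed.

(** Uniqueness is applied to squares, so events come back through the square root. Squaring and
    taking the root gives |x|, which is x wherever the density is nonzero. *)
Lemma sigma_hat_prob_sqrt_sqr (A : set R) :
  sigma_hat_prob [set x | A (Num.sqrt (x ^+ 2))] =
  (\int[mu]_(x in A) (sigma_hat_pdf N sigma x)%:E)%E.
Proof.
transitivity (\int[mu]_(x in [set x | A (Num.sqrt (x ^+ 2))]) (sigma_hat_pdf N sigma x)%:E)%E => //.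
rewrite integral_mkcond [RHS]integral_mkcond; apply: eq_integral => x _.
rewrite !patchE; have [x0|x0] := leP 0 x.
  by congr (if _ then _ else _); apply/idP/idP; rewrite !inE/= sqrtr_sqr ger0_norm.
have -> : sigma_hat_pdf N sigma x = 0 by rewrite /sigma_hat_pdf leNgt x0.
by do 2 case: ifP.
Qed.

End sigma_hat_law.

Lemma sigma_hat_has_pdf d (T : measurableType d) (R : realType)
    (P : probability T R) (N : nat) (x : 'I_N -> {RV P >-> 4.-tuple R})
    (S : 'M[R]_4) (i q : 'I_4) (sigma : R) :
  (0 < N)%N -> 0 < sigma -> i != q -> mutually_independent x ->
  (forall n, gaussian_vector (x n)) -> (forall n, zero_mean (x n)) ->
  (forall n, has_covariance_mx (x n) S) ->
  S i i = sigma ^+ 2 -> S q q = sigma ^+ 2 -> S i q = 0 ->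
  has_pdf P (sigma_hat x i q) (sigma_hat_pdf N sigma).
Proof.
move=> N0 s0 iq indep gauss mean0 cov Sii Sqq Siq.
have mX := measurable_sigma_hat x i q.
have X0 w : 0 <= sigma_hat x i q w := sigma_hat_ge0 x i q w.
split => //.
- exact: measurable_sigma_hat_pdf.
- exact: sigma_hat_pdf_ge0.
move=> A mA.
have mU : measurable_fun setT (fun w => sigma_hat x i q w ^+ 2) by exact: measurable_funX.
have mV : measurable_fun setT (fun y : measurableTypeR R => (y : R) ^+ 2) by exact: measurable_funX.
pose U : {mfun T >-> R} := mfun_Sub (mem_set mU).
pose V : {mfun (measurableTypeR R) >-> R} := mfun_Sub (mem_set mV).
have UV (l : R) : 0 < l ->
    (\int[P]_w (expR (- (l * U w)))%:E =
     \int[sigma_hat_prob N0 s0]_y (expR (- (l * V y)))%:E)%E.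
  move=> l0.
  have := laplace_sigma_hat_sqr N0 (sqr_ge0 sigma) iq indep gauss mean0 cov Sii Sqq Siq l0.
  by rewrite -(laplace_sigma_hat_prob N0 s0 (ltW l0)).
have mB : measurable [set u : R | A (Num.sqrt u)].
  have ms : measurable_fun setT (Num.sqrt : R -> R).
    by apply: continuous_measurable_fun; exact: sqrt_continuous.
  by rewrite -[X in measurable X]setTI; exact: ms.
have := @laplace_law_unique _ _ _ _ R P (sigma_hat_prob N0 s0) U V
  (fun w => sqr_ge0 _) (fun y => sqr_ge0 _) UV _ mB.
rewrite -(sigma_hat_prob_sqrt_sqr N0 s0) => <-; congr (P _).
by apply/seteqP; split => w /=; rewrite sqrtr_sqr ger0_norm.
Qed.

(** * Diagonal blocks of the covariance matrix *)

Section cov_mx_entries.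
Context (R : realType) (r : radar) (sigma1 sigma2 rho phi : R).
Local Notation S := (cov_mx r sigma1 sigma2 rho phi).

(** Explicit ordinals of ['I_4] have to be recognised as shifts in ['I_(2 + 2)] before the block
    lemmas apply; equality of values suffices. *)
Let lE (k : 'I_2) (hk : (k < 4)%N) : Ordinal hk = lshift 2 k :> 'I_(2 + 2).
Proof. exact: val_inj. Qed.

Let rE (k : 'I_2) (hk : (2 + k < 4)%N) : Ordinal hk = rshift 2 k :> 'I_(2 + 2).
Proof. exact: val_inj. Qed.

Lemma cov_mx_ul (k l : 'I_2) (hk : (k < 4)%N) (hl : (l < 4)%N) :
  S (Ordinal hk) (Ordinal hl) = (sigma1 ^+ 2) *+ (k == l).
Proof.
rewrite /cov_mx lE (lE hl); apply: etrans (block_mxEul _ _ _ _ _ _) _.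
by rewrite mxE.
Qed.

Lemma cov_mx_dr (k l : 'I_2) (hk : (2 + k < 4)%N) (hl : (2 + l < 4)%N) :
  S (Ordinal hk) (Ordinal hl) = (sigma2 ^+ 2) *+ (k == l).
Proof.
rewrite /cov_mx rE (rE hl); apply: etrans (block_mxEdr _ _ _ _ _ _) _.
by rewrite mxE.
Qed.

End cov_mx_entries.

Theorem proposition2 (R : realType) (d : measure_display)
    (T : measurableType d) (P : probability T R) (N : nat)
    (x : 'I_N -> {RV P >-> 4.-tuple R})
    (r : radar) (sigma1 sigma2 rho phi : R) :
  (1 <= N)%N ->
  0 < sigma1 -> 0 < sigma2 -> 0 <= rho -> rho <= 1 ->
  mutually_independent x ->
  identically_distributed x ->
  (forall n : 'I_N, gaussian_vector (x n)) ->
  (forall n : 'I_N, zero_mean (x n)) ->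
  (forall n : 'I_N,
     has_covariance_mx (x n) (cov_mx r sigma1 sigma2 rho phi)) ->
  has_pdf P (sigma_hat1 x) (sigma_hat_pdf N sigma1) /\
  has_pdf P (sigma_hat2 x) (sigma_hat_pdf N sigma2).
Proof.
move=> N1 s1 s2 _ _ indep _ gauss mean0 cov; split.
- apply: (sigma_hat_has_pdf N1 s1 _ indep gauss mean0 cov) => //.
  + exact: (@cov_mx_ul _ _ _ _ _ _ ord0 ord0).
  + exact: (@cov_mx_ul _ _ _ _ _ _ ord_max ord_max).
  + exact: (@cov_mx_ul _ _ _ _ _ _ ord0 ord_max).
- apply: (sigma_hat_has_pdf N1 s2 _ indep gauss mean0 cov) => //.
  + exact: (@cov_mx_dr _ _ _ _ _ _ ord0 ord0).
  + exact: (@cov_mx_dr _ _ _ _ _ _ ord_max ord_max).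
  + exact: (@cov_mx_dr _ _ _ _ _ _ ord0 ord_max).
Qed.
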